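(* Let $Q$ be a commutative ring, $R=Q/I$ a cyclic $Q$-algebra, and $M$ an $R$-module. Let $A\xrightarrow{\simeq}R$ (with $A_0=Q$) and $G\xrightarrow{\simeq}M$ be $Q$-projective resolutions with an $A_\infty$-algebra structure $(m_n)$ and an $A_\infty$ $A$-module structure $(m_n^G)$, respectively. There is a complex $\operatorname{syz}_R(G)$, built from $A$, $G$ and these $A_\infty$-structures, namely $$\operatorname{syz}_R(G)=\operatorname{cone}(\phi)[-2],\qquad \phi=s\,m_2^G|_{A_+[1]\otimes G_0}:A_+[1]\otimes G_0\to G_+[1],$$ with a canonical $A_\infty$ $A$-module structure (that is, one determined by the given structures $(m_n)$ and $(m_n^G)$, with no further choices) and a quasi-isomorphism $$\operatorname{syz}_R(G)\xrightarrow{\simeq}\Omega_R(M).$$ Thus $\operatorname{syz}_R(G)$ is a $Q$-projective resolution of the first $R$-syzygy of $M$.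
   Context: Conventions: $\otimes=\otimes_Q$. Complexes are graded homologically. $M[1]_n=M_{n-1}$, $d_{M[1]}=-d_M$, $M[-2]_n=M_{n+2}$, and $s:M\to M[1]$ is the degree $1$ map $s(m)=m$. Signs: $(f\otimes g)(x\otimes y)=(-1)^{|g||x|}f(x)\otimes g(y)$. $A_+=A_{\ge1}$ and $G_+=G_{\ge1}$, with the induced differentials (zero on $A_1$, resp. $G_1$). The complex $A_+[1]\otimes G_0$ has differential $m_1\otimes1$, and $\phi$ above is a morphism of complexes. For a morphism of complexes $f:M\to N$, $\operatorname{cone}(f)=M[1]\oplus N$ with differential $\begin{pmatrix}d^{M[1]}&0\\ fs^{-1}&d^N\end{pmatrix}$. The first syzygy of $M$ over $R$ is $\Omega_R(M)=\ker(R\otimes G_0\to M)$, the map being induced by the augmentation $G_0\to M$. An $A_\infty$-algebra structure on $A$ is a sequence of degree $-1$ maps $m_n:A_+[1]^{\otimes n}\to A_+[1]$, $n\ge1$, such that $m_1$ is the differential of the complex $A_+[1]$; $m_1m_2+m_2(m_1\otimes1+1\otimes m_1)=d_1^A\otimes1-1\otimes d_1^A$, where $d_1^A:A_1\to A_0=Q$ is viewed as a degree $-2$ map $A_+[1]\to A_0$ and $A_0\otimes A_+[1]=A_+[1]=A_+[1]\otimes A_0$; and $\sum_{i=1}^n\sum_{j=0}^{n-i}m_{n-i+1}(1^{\otimes j}\otimes m_i\otimes1^{\otimes n-i-j})=0$ for all $n\ge3$. Given $(m_n)$, an $A_\infty$ $A$-module structure on a complex $G$ of $Q$-modules is a sequence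 of degree $-1$ maps $m_n^G:A_+[1]^{\otimes n-1}\otimes G\to G$, $n\ge1$, such that $m_1^G=d^G$; $m_1^Gm_2^G+m_2^G(m_1\otimes1+1\otimes m_1^G)=d_1^A\otimes1$; and $\sum_{i=1}^n\sum_{j=0}^{n-i}m^G_{n-i+1}(1^{\otimes j}\otimes m_i\otimes1^{\otimes n-i-j})=0$ for all $n\ge3$, where $m_i$ means $m_i^G$ when $j=n-i$. *)

(* Defs.v *)
From HB Require Import structures.
From mathcomp Require Import all_boot all_algebra.
From mathcomp Require Import boolp.

Set Implicit Arguments.
Unset Strict Implicit.
Unset Printing Implicit Defensive.

Import GRing.Theory.
Local Open Scope ring_scope.
Local Open Scope quotient_scope.

(* The tensor product over Q: formal sums of pairs, as lists, modulo the
   congruence generated by the bilinearity relations. *)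
Section Tensor.
Context {Q : comPzRingType} (M N : lmodType Q).

Inductive tensor_rel : seq (M * N) -> seq (M * N) -> Prop :=
| tensor_refl s : tensor_rel s s
| tensor_sym s t : tensor_rel s t -> tensor_rel t s
| tensor_trans s t u : tensor_rel s t -> tensor_rel t u -> tensor_rel s u
| tensor_cat s s' t t' :
    tensor_rel s s' -> tensor_rel t t' -> tensor_rel (s ++ t) (s' ++ t')
| tensor_comm s t : tensor_rel (s ++ t) (t ++ s)
| tensor_zero y : tensor_rel [:: (0, y)] [::]
| tensor_addl x x' y : tensor_rel [:: (x + x', y)] [:: (x, y); (x', y)]
| tensor_addr x y y' : tensor_rel [:: (x, y + y')] [:: (x, y); (x, y')]
| tensor_scale c x y : tensor_rel [:: (c *: x, y)] [:: (x, c *: y)].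

Definition tensor_relb (s t : seq (M * N)) : bool := `[< tensor_rel s t >].

Lemma tensor_relb_equiv : equiv_class_of tensor_relb.
Proof.
split=> [s|s t|t s u].
- exact/asboolP/tensor_refl.
- by apply/asboolP/asboolP; apply: tensor_sym.
- by move=> /asboolP st /asboolP tu; apply/asboolP; apply: tensor_trans st tu.
Qed.

Canonical tensor_equiv := EquivRelPack tensor_relb_equiv.

Definition tensor : Type := {eq_quot tensor_equiv}.
HB.instance Definition _ := Choice.on tensor.
HB.instance Definition _ := EqQuotient.on tensor.

Definition pure (x : M) (y : N) : tensor := \pi_tensor [:: (x, y)].

Lemma tensor_piP s t : tensor_rel s t <-> \pi_tensor s = \pi_tensor t.
Proof.
split=> [st|/eqmodP/asboolP //].
by apply/eqmodP/asboolP.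
Qed.

Lemma tensor_quotW (P : tensor -> Prop) :
  (forall s, P (\pi_tensor s)) -> forall u, P u.
Proof. by move=> Ps u; rewrite -[u]reprK. Qed.

Lemma tensor_reprP s : tensor_rel (repr (\pi_tensor s)) s.
Proof. by apply/tensor_piP; rewrite reprK. Qed.

Definition tensor_scale_seq (c : Q) (s : seq (M * N)) :=
  [seq (c *: p.1, p.2) | p <- s].

Lemma tensor_scale_seqP c s t :
  tensor_rel s t -> tensor_rel (tensor_scale_seq c s) (tensor_scale_seq c t).
Proof.
elim=> {s t} [s|s t _|s t u _ IH1 _ IH2|s s' t t' _ IH1 _ IH2|s t|y|x x' y
             |x y y'|a x y].
- exact: tensor_refl.
- exact: tensor_sym.
- exact: tensor_trans IH1 IH2.
- by rewrite /tensor_scale_seq !map_cat; apply: tensor_cat.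
- by rewrite /tensor_scale_seq !map_cat; apply: tensor_comm.
- by rewrite /= scaler0; apply: tensor_zero.
- by rewrite /= scalerDr; apply: tensor_addl.
- exact: tensor_addr.
- by rewrite /= scalerA mulrC -scalerA; apply: tensor_scale.
Qed.

Definition tensor0 : tensor := \pi_tensor [::].
Definition tensorD (u v : tensor) : tensor := \pi_tensor (repr u ++ repr v).
Definition tensorZ (c : Q) (u : tensor) : tensor :=
  \pi_tensor (tensor_scale_seq c (repr u)).
Definition tensorN (u : tensor) : tensor := tensorZ (-1) u.

Lemma tensorD_pi s t :
  tensorD (\pi_tensor s) (\pi_tensor t) = \pi_tensor (s ++ t).
Proof. by apply/tensor_piP; apply: tensor_cat; apply: tensor_reprP. Qed.

Lemma tensorZ_pi c s :
  tensorZ c (\pi_tensor s) = \pi_tensor (tensor_scale_seq c s).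
Proof.
by apply/tensor_piP; apply: tensor_scale_seqP; apply: tensor_reprP.
Qed.

Lemma tensor_addA : associative tensorD.
Proof.
elim/tensor_quotW=> s; elim/tensor_quotW=> t; elim/tensor_quotW=> u.
by rewrite !tensorD_pi catA.
Qed.

Lemma tensor_addC : commutative tensorD.
Proof.
elim/tensor_quotW=> s; elim/tensor_quotW=> t; rewrite !tensorD_pi.
exact/tensor_piP/tensor_comm.
Qed.

Lemma tensor_add0 : left_id tensor0 tensorD.
Proof. by elim/tensor_quotW=> s; rewrite tensorD_pi. Qed.

Lemma tensor_addN : left_inverse tensor0 tensorN tensorD.
Proof.
elim/tensor_quotW=> s; rewrite /tensorN tensorZ_pi tensorD_pi.
apply/tensor_piP; elim: s => [|[x y] s IH] /=; first exact: tensor_refl.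
rewrite -/(tensor_scale_seq _ _).
apply: (@tensor_trans _
  ([:: (-1 *: x, y); (x, y)] ++ (tensor_scale_seq (-1) s ++ s))).
  rewrite -[X in tensor_rel X _]/([:: (-1 *: x, y)] ++
    (tensor_scale_seq (-1) s ++ ([:: (x, y)] ++ s))).
  rewrite -[[:: _; _]]/([:: (-1 *: x, y)] ++ [:: (x, y)]) -catA.
  apply: tensor_cat; first exact: tensor_refl.
  by rewrite !catA; apply: tensor_cat; [apply: tensor_comm|apply: tensor_refl].
rewrite -[[::]]/([::] ++ [::]); apply: tensor_cat => //.
apply: (@tensor_trans _ [:: (-1 *: x + x, y)]).
  exact/tensor_sym/tensor_addl.
by rewrite scaleN1r addNr; apply: tensor_zero.
Qed.

HB.instance Definition _ := GRing.isZmodule.Build tensor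
  tensor_addA tensor_addC tensor_add0 tensor_addN.

Lemma tensor_scaleA c c' (u : tensor) :
  tensorZ c (tensorZ c' u) = tensorZ (c * c') u.
Proof.
elim/tensor_quotW: u => s; rewrite !tensorZ_pi /tensor_scale_seq -map_comp.
by congr (\pi_tensor _); apply: eq_map => p /=; rewrite scalerA.
Qed.

Lemma tensor_scale1 : left_id 1 tensorZ.
Proof.
elim/tensor_quotW=> s; rewrite tensorZ_pi /tensor_scale_seq.
congr (\pi_tensor _); rewrite -[RHS]map_id.
by apply: eq_map => -[x y] /=; rewrite scale1r.
Qed.

Lemma tensor_scaleDr : right_distributive tensorZ +%R.
Proof.
move=> c; elim/tensor_quotW=> s; elim/tensor_quotW=> t.
rewrite -[X in tensorZ _ X]/(tensorD _ _) -[RHS]/(tensorD _ _).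
by rewrite tensorD_pi !tensorZ_pi tensorD_pi /tensor_scale_seq map_cat.
Qed.

Lemma tensor_scaleDl (u : tensor) : {morph tensorZ^~ u : c c' / c + c'}.
Proof.
move=> c c'; elim/tensor_quotW: u => s; rewrite -[RHS]/(tensorD _ _).
rewrite !tensorZ_pi tensorD_pi; apply/tensor_piP.
elim: s => [|[x y] s IH] /=; first exact: tensor_refl.
rewrite -!/(tensor_scale_seq _ _).
apply: (@tensor_trans _ ([:: (c *: x, y); (c' *: x, y)] ++
    (tensor_scale_seq c s ++ tensor_scale_seq c' s))); last first.
  rewrite -[X in tensor_rel _ X]/([:: (c *: x, y)] ++
    (tensor_scale_seq c s ++ ([:: (c' *: x, y)] ++ tensor_scale_seq c' s))).
  rewrite -[[:: _; _]]/([:: (c *: x, y)] ++ [:: (c' *: x, y)]) -catA.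
  apply: tensor_cat; first exact: tensor_refl.
  by rewrite !catA; apply: tensor_cat; [apply: tensor_comm|apply: tensor_refl].
rewrite -cat1s; apply: tensor_cat => //.
by rewrite scalerDl; apply: tensor_addl.
Qed.

HB.instance Definition _ := GRing.Zmodule_isLmodule.Build Q tensor
  tensor_scaleA tensor_scale1 tensor_scaleDr tensor_scaleDl.

(* The map out of the tensor product induced by b; it is independent of the
   chosen representative when b is bilinear (tlift_pure, tlift_linear). *)
Definition tlift (P : lmodType Q) (b : M -> N -> P) (u : tensor) : P :=
  \sum_(p <- repr u) b p.1 p.2.

Definition bilinear_map (P : lmodType Q) (b : M -> N -> P) : Prop :=
  (forall y, linear (b^~ y)) /\ (forall x, linear (b x)).

Section Lift.
Variables (P : lmodType Q) (b : M -> N -> P).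
Hypothesis b_bilin : bilinear_map b.

Lemma tlift_pi s : tlift b (\pi_tensor s) = \sum_(p <- s) b p.1 p.2.
Proof.
have [bl br] := b_bilin; rewrite /tlift.
have := tensor_reprP s; move: (repr _) => r rs.
elim: rs => {s r} [s|s t _|s t u _ -> _ ->|s s' t t' _ IH1 _ IH2|s t|y|x x' y
  |x y y'|a x y] //.
- by rewrite !big_cat /= IH1 IH2.
- by rewrite !big_cat /= addrC.
- rewrite big_seq1 big_nil /=.
  by have := bl y (-1) 0 0; rewrite scaler0 addr0 scaleN1r addNr.
- rewrite !(big_cons, big_nil) !addr0 /=.
  by have := bl y 1 x x'; rewrite !scale1r.
- rewrite !(big_cons, big_nil) !addr0 /=.
  by have := br x 1 y y'; rewrite !scale1r.
- rewrite !(big_cons, big_nil) !addr0 /=.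
  have b0 : b 0 y = 0.
    by have := bl y (-1) 0 0; rewrite scaler0 addr0 scaleN1r addNr.
  have b0' : b x 0 = 0.
    by have := br x (-1) 0 0; rewrite scaler0 addr0 scaleN1r addNr.
  have := bl y a x 0; have := br x a y 0.
  by rewrite !addr0 b0 b0' !addr0 => -> ->.
Qed.

Lemma tlift_pure x y : tlift b (pure x y) = b x y.
Proof. by rewrite tlift_pi big_seq1. Qed.

Lemma tlift_linear : linear (tlift b).
Proof.
have [bl br] := b_bilin.
move=> c; elim/tensor_quotW=> s; elim/tensor_quotW=> t.
rewrite -[X in tlift b X]/(tensorD (tensorZ _ _) _).
rewrite tensorZ_pi tensorD_pi !tlift_pi big_cat big_map /=.
congr (_ + _); rewrite scaler_sumr; apply: eq_bigr => p _.
have := bl p.2 c p.1 0; rewrite !addr0 => ->.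
suff -> : b 0 p.2 = 0 by rewrite addr0.
by have := bl p.2 (-1) 0 0; rewrite scaler0 addr0 scaleN1r addNr.
Qed.

End Lift.

Lemma pure_bilinear : bilinear_map pure.
Proof.
split=> [y c x x'|x c y y']; rewrite -[RHS]/(tensorD (tensorZ _ _) _);
  rewrite tensorZ_pi tensorD_pi; apply/tensor_piP.
  exact: tensor_addl.
apply: tensor_trans (tensor_addr _ _ _) _.
rewrite -cat1s -[X in tensor_rel _ X]cat1s; apply: tensor_cat.
  exact/tensor_sym/tensor_scale.
exact: tensor_refl.
Qed.

Lemma tensor_ind (p : tensor -> Prop) :
  p 0 -> (forall x y u, p u -> p (pure x y + u)) -> forall u, p u.
Proof.
move=> p0 pD; elim/tensor_quotW=> s; elim: s => [|[x y] s IH] //.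
suff -> : \pi_tensor ((x, y) :: s) = pure x y + \pi_tensor s by apply: pD.
by rewrite -[RHS]/(tensorD _ _) tensorD_pi.
Qed.

End Tensor.
Arguments pure {Q M N} x y.

Definition mklin {Q : comPzRingType} {U V : lmodType Q} (f : U -> V)
    (f_lin : linear f) : {linear U -> V} :=
  HB.pack f (GRing.isLinear.Build Q U V *:%R f f_lin).

Section TensorMap.
Context {Q : comPzRingType} {M M' : lmodType Q} (N : lmodType Q).
Variable f : {linear M -> M'}.

Lemma tmapl_bilinear : bilinear_map (fun x (y : N) => pure (f x) y).
Proof.
have [bl br] := pure_bilinear M' N.
by split=> [y c x x'|x c y y']; rewrite ?linearP ?bl ?br.
Qed.

Definition tmapl : {linear tensor M N -> tensor M' N} :=
  mklin (tlift_linear tmapl_bilinear).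

Lemma tmapl_pure x y : tmapl (pure x y) = pure (f x) y.
Proof. exact: (tlift_pure tmapl_bilinear). Qed.

End TensorMap.

(* Chain complexes concentrated in degrees n >= 0; cdiff X n goes from degree
   n.+1 to degree n. *)
Record complex (Q : comPzRingType) := Complex {
  cmod :> nat -> lmodType Q;
  cdiff : forall n, {linear cmod n.+1 -> cmod n};
  cdiffK : forall n x, cdiff n (cdiff n.+1 x) = 0 }.
Arguments cdiff {Q} X n : rename.
Arguments cdiffK {Q} X n : rename.

Record chain_map (Q : comPzRingType) (X Y : complex Q) := ChainMap {
  cmap :> forall n, {linear X n -> Y n};
  cmapC : forall n x, cmap n (cdiff X n x) = cdiff Y n (cmap n.+1 x) }.
Arguments cmap {Q X Y} f n : rename.

Section Complexes.
Context {Q : comPzRingType}.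
Implicit Types X Y : complex Q.

Definition zeromod : lmodType Q := 'rV[Q]_0.

Lemma zeromod_eq (x y : zeromod) : x = y.
Proof. by rewrite [x]thinmx0 [y]thinmx0. Qed.

Definition cycle X n : X n -> Prop :=
  if n is k.+1 return X n -> Prop then fun x => cdiff X k x = 0
  else fun=> True.

Definition boundary X n (x : X n) : Prop := exists y, cdiff X n y = x.

(* For every n the map induced on H_n = cycles / boundaries is injective and
   surjective. *)
Definition quasi_iso X Y (f : chain_map X Y) : Prop := forall n,
  (forall x, cycle x -> boundary (f n x) -> boundary x) /\
  (forall y, cycle y -> exists2 x, cycle x & boundary (f n x - y)).

Definition stalk_mod (N : lmodType Q) (n : nat) : lmodType Q :=
  if n is 0 then N else zeromod.

Definition stalk (N : lmodType Q) : complex Q :=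
  @Complex Q (stalk_mod N) (fun=> \0) (fun _ _ => erefl).

Definition projective (P : lmodType Q) : Prop :=
  forall (U V : lmodType Q) (p : {linear U -> V}) (f : {linear P -> V}),
    (forall v, exists u, p u = v) ->
    exists g : {linear P -> U}, forall x, p (g x) = f x.

Definition resolution X (N : lmodType Q) (f : chain_map X (stalk N)) : Prop :=
  (forall n, projective (X n)) /\ quasi_iso f.

(* X_{>= 1}, with zero differential on X_1 *)
Definition plus_mod X (n : nat) : lmodType Q :=
  if n is k.+1 then X k.+1 else zeromod.

Definition plus_diff X n : {linear plus_mod X n.+1 -> plus_mod X n} :=
  match n with 0 => \0 | k.+1 => cdiff X k.+1 end.

Lemma plus_diffK X n x : plus_diff X n (plus_diff X n.+1 x) = 0.
Proof. by case: n x => // n x; apply: cdiffK. Qed.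

Definition plus X : complex Q := Complex (@plus_diffK X).

(* X[1] *)
Definition shift_mod X (n : nat) : lmodType Q :=
  if n is k.+1 then X k else zeromod.

Definition shift_diff X n : {linear shift_mod X n.+1 -> shift_mod X n} :=
  match n with 0 => \0 | k.+1 => \- (cdiff X k) end.

Lemma shift_diffK X n x : shift_diff X n (shift_diff X n.+1 x) = 0.
Proof. by case: n x => // n x; rewrite /= linearN cdiffK !oppr0. Qed.

Definition shift X : complex Q := Complex (@shift_diffK X).

(* X[-2]; no information is lost when X_0 = X_1 = 0, as is the case below. *)
Definition unshift2 X : complex Q :=
  @Complex Q (fun n => X n.+2) (fun n => cdiff X n.+2)
    (fun n => cdiffK X n.+2).

(* X (x) N with differential d (x) 1 *)
Definition tens_diff X (N : lmodType Q) n :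
  {linear tensor (X n.+1) N -> tensor (X n) N} := tmapl N (cdiff X n).

Lemma tens_diffK X N n x : tens_diff X N n (tens_diff X N n.+1 x) = 0.
Proof.
move: x; apply: tensor_ind => [|x y u IH]; first by rewrite !linear0.
rewrite 2!linearD IH addr0 /tens_diff !tmapl_pure cdiffK.
have := (pure_bilinear (X n) N).1 y (-1) 0 0.
by rewrite scaler0 addr0 scaleN1r addNr.
Qed.

Definition tens X (N : lmodType Q) : complex Q := Complex (@tens_diffK X N).

Section Cone.
Variables (X Y : complex Q) (f : chain_map X Y).

Definition cone_mod (n : nat) : lmodType Q := (shift X n * Y n)%type.

Definition cone_fun n (z : cone_mod n.+1) : cone_mod n :=
  (cdiff (shift X) n z.1, f n z.1 + cdiff Y n z.2).

Lemma cone_fun_linear n : linear (@cone_fun n).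
Proof.
move=> c [x y] [x' y']; congr (_, _) => /=; rewrite ?linearP //.
by rewrite scalerDr addrACA.
Qed.

Definition cone_diff n : {linear cone_mod n.+1 -> cone_mod n} :=
  mklin (@cone_fun_linear n).

Lemma cone_diffK n z : cone_diff n (cone_diff n.+1 z) = 0.
Proof.
case: z => x y; rewrite /= /cone_fun /=; congr (_, _).
  exact: (cdiffK (shift X)).
by rewrite linearD cdiffK addr0 linearN cmapC addNr.
Qed.

Definition cone : complex Q := Complex cone_diffK.

End Cone.

(* Homogeneous elements, with their degree as tag *)
Definition helt X : Type := {n : nat & X n}.
Definition hel X n (x : X n) : helt X := existT (fun n => X n) n x.

(* The component in degree t of a homogeneous element *)
Definition comp X (x : helt X) (t : nat) : X t := tagged_as (hel (0 : X t)) x.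

Definition deg X (s : seq (helt X)) : nat := \sum_(x <- s) tag x.

End Complexes.
Arguments hel {Q X n} x.

(* The R-module V viewed as a Q-module along pi *)
Definition restr (Q R : comPzRingType) (pi : {rmorphism Q -> R})
  (V : lmodType R) : Type := V.

Section Restriction.
Context {Q R : comPzRingType} (pi : {rmorphism Q -> R}).
Local Notation restr := (restr pi).

Section Instance.
Variable V : lmodType R.

HB.instance Definition _ := GRing.Zmodule.copy (restr V) V.

Definition restr_scale (q : Q) (v : restr V) : restr V := pi q *: (v : V).

Lemma restr_scaleA q q' v :
  restr_scale q (restr_scale q' v) = restr_scale (q * q') v.
Proof. by rewrite /restr_scale scalerA rmorphM. Qed.

Lemma restr_scale1 : left_id 1 restr_scale.
Proof. by move=> v; rewrite /restr_scale rmorph1 scale1r. Qed.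

Lemma restr_scaleDr : right_distributive restr_scale +%R.
Proof. by move=> q v v'; apply: scalerDr. Qed.

Lemma restr_scaleDl v : {morph restr_scale^~ v : q q' / q + q'}.
Proof. by move=> q q'; rewrite /restr_scale rmorphD scalerDl. Qed.

HB.instance Definition _ := GRing.Zmodule_isLmodule.Build Q (restr V)
  restr_scaleA restr_scale1 restr_scaleDr restr_scaleDl.

End Instance.

(* R (x)_Q N as an R-module *)
Section BaseExt.
Variable N : lmodType Q.

Definition base_ext : Type := tensor (restr R^o) N.
HB.instance Definition _ := GRing.Zmodule.copy base_ext (tensor (restr R^o) N).

Lemma mulr_restr_linear (r : R) :
  linear (fun x : restr R^o => r * x : restr R^o).
Proof.
move=> q x y; rewrite mulrDr; congr (_ + _).
by rewrite -[RHS]/(pi q * (r * x)) -[q *: x]/(pi q * x) mulrCA.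
Qed.

Definition base_scale (r : R) (u : base_ext) : base_ext :=
  tmapl N (mklin (mulr_restr_linear r)) u.

Lemma base_scale_pure r (x : restr R^o) y :
  base_scale r (pure x y) = pure (r * x : restr R^o) y.
Proof. exact: tmapl_pure. Qed.

Lemma base_scaleD r : {morph base_scale r : u v / u + v}.
Proof. by move=> u v; apply: linearD. Qed.

Lemma base_scale0 r : base_scale r 0 = 0.
Proof. exact: linear0. Qed.

Lemma base_scaleA r r' u :
  base_scale r (base_scale r' u) = base_scale (r * r') u.
Proof.
move: u; apply: tensor_ind => [|x y u IH]; first by rewrite !base_scale0.
by rewrite !base_scaleD IH !base_scale_pure mulrA.
Qed.

Lemma base_scale1 : left_id 1 base_scale.
Proof.
apply: tensor_ind => [|x y u IH]; first by rewrite base_scale0.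
by rewrite base_scaleD IH base_scale_pure mul1r.
Qed.

Lemma base_scaleDr : right_distributive base_scale +%R.
Proof. by move=> r u v; rewrite base_scaleD. Qed.

Lemma base_scaleDl u : {morph base_scale^~ u : r r' / r + r'}.
Proof.
move=> r r'; move: u; apply: tensor_ind => [|x y u IH].
  by rewrite !base_scale0 addr0.
rewrite !base_scaleD IH !base_scale_pure mulrDl addrACA; congr (_ + _).
have := (pure_bilinear (restr R^o) N).1 y 1 (r * x) (r' * x).
by rewrite !scale1r.
Qed.

HB.instance Definition _ := GRing.Zmodule_isLmodule.Build R base_ext
  base_scaleA base_scale1 base_scaleDr base_scaleDl.

End BaseExt.

Section Syzygy.
Variables (M : lmodType R) (N : lmodType Q) (e : {linear N -> restr M}).

Lemma base_ev_bilinear :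
  bilinear_map (fun (r : restr R^o) (y : N) => r *: (e y : M) : restr M).
Proof.
split=> [y q r r'|r q y y'].
  by rewrite scalerDl; congr (_ + _); rewrite -[RHS]/(pi q *: _) scalerA.
rewrite linearP scalerDr; congr (_ + _).
by rewrite -[q *: e y]/(pi q *: _) -[RHS]/(pi q *: _) !scalerA mulrC.
Qed.

(* The R-linear map R (x) N -> M induced by e *)
Definition base_ev (u : base_ext N) : M := tlift
  (fun (r : restr R^o) (y : N) => r *: (e y : M) : restr M) u.

Lemma base_ev_linear : linear base_ev.
Proof.
have evD : {morph base_ev : u v / u + v}.
  move=> u v; have := tlift_linear base_ev_bilinear 1 u v.
  by rewrite !scale1r.
have ev0 : base_ev 0 = 0.
  by apply: (addIr (base_ev 0)); rewrite -evD !add0r.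
move=> r u v; rewrite evD; congr (_ + _).
move: u; apply: tensor_ind => [|x y u IH].
  by rewrite scaler0 ev0 scaler0.
rewrite -[X in _ *: X]/((pure x y : base_ext N) + u) scalerDr !evD scalerDr IH.
congr (_ + _); rewrite -[r *: _]/(base_scale r _) base_scale_pure.
by rewrite /base_ev !(tlift_pure base_ev_bilinear) scalerA.
Qed.

Definition syz_pred : {pred base_ext N} := fun u => base_ev u == 0.

Fact syz_pred_submod : submod_closed syz_pred.
Proof.
pose f : {linear base_ext N -> M} :=
  HB.pack base_ev (GRing.isLinear.Build R _ _ *:%R _ base_ev_linear).
split=> [|r u v]; first exact/eqP/(linear0 f).
rewrite !unfold_in => /eqP u0 /eqP v0.
by rewrite base_ev_linear u0 v0 scaler0 addr0.
Qed.

HB.instance Definition _ :=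
  GRing.isSubmodClosed.Build R (base_ext N) syz_pred syz_pred_submod.

(* The kernel of R (x) N -> M; for N = G_0 it is the first syzygy of M *)
Record syzygy : Type := Syzygy {
  syz_val : base_ext N;
  _ : syz_val \in syz_pred }.

HB.instance Definition _ := [isSub for syz_val].
HB.instance Definition _ := [Choice of syzygy by <:].
HB.instance Definition _ := [SubChoice_isSubLmodule of syzygy by <:].

End Syzygy.
End Restriction.

(* An operation of several variables is given on lists of homogeneous elements
   by its components: op s t is the component in degree t of its value.  A
   degree -1 map of n variables is the restriction to lists of length n. *)
Section AInfinity.
Context {Q : comPzRingType} (A : complex Q) (unitA : {linear A 0%N -> Q^o}).

(* A_+[1] *)
Definition bar : complex Q := shift (plus A).

(* d_1^A, as a map of degree -2 from A_+[1] to Q = A_0 *)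
Definition d1 (x : helt bar) : Q :=
  let: existT n a := x in
  match n return bar n -> Q with
  | 2 => fun a : A 1%N => unitA (cdiff A 0%N a)
  | _ => fun=> 0
  end a.

Definition alg_ops : Type := seq (helt bar) -> forall t, bar t.

Section Algebra.
Variable m : alg_ops.

Definition alg_val (s : seq (helt bar)) : helt bar := hel (m s (deg s).-1).

(* For s of length n, the value at s of
   \sum_i \sum_j m_{n-i+1} (1^{(x) j} (x) m_i (x) 1^{(x) n-i-j}) *)
Definition alg_sum (s : seq (helt bar)) (t : nat) : bar t :=
  \sum_(1 <= i < (size s).+1) \sum_(0 <= j < (size s - i).+1)
    (-1) ^+ deg (take j s) *:
      m (take j s ++ alg_val (take i (drop j s)) :: drop (j + i) s) t.

Record Ainf_algebra_axioms : Prop := {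
  alg_deg : forall s t, t.+1 != deg s -> m s t = 0;
  alg_lin : forall s1 s2 n t,
    linear (fun x : bar n => m (s1 ++ hel x :: s2) t);
  alg_m1 : forall n (x : bar n.+1), m [:: hel x] n = cdiff bar n x;
  alg_sum2 : forall x y t,
    alg_sum [:: x; y] t = d1 x *: comp y t - d1 y *: comp x t;
  alg_sum3 : forall s t, (3 <= size s)%N -> alg_sum s t = 0 }.

End Algebra.

Record Ainf_algebra := {
  alg_op :> seq (helt bar) -> forall t, bar t;
  alg_ax : Ainf_algebra_axioms alg_op }.

Section Module.
Variables (m : alg_ops) (G : complex Q).

Definition mod_ops : Type :=
  seq (helt bar) -> helt G -> forall t, G t.

Variable mG : mod_ops.

Definition mod_val (s : seq (helt bar)) (g : helt G) : helt G :=
  hel (mG s g (deg s + tag g).-1).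

(* The analogous sum for m^G; the variables are s, of length n - 1, and g, so
   the inner operation reaches g exactly when j = n - i. *)
Definition mod_sum (s : seq (helt bar)) (g : helt G) (t : nat) : G t :=
  let n := (size s).+1 in
  \sum_(1 <= i < n.+1) \sum_(0 <= j < (n - i).+1)
    (-1) ^+ deg (take j s) *:
      (if j == (n - i)%N then mG (take j s) (mod_val (drop j s) g) t
       else mG (take j s ++ alg_val m (take i (drop j s)) :: drop (j + i) s)
              g t).

Record Ainf_module_axioms : Prop := {
  mod_deg : forall s g t, t.+1 != (deg s + tag g)%N -> mG s g t = 0;
  mod_lin : forall s1 s2 g n t,
    linear (fun x : bar n => mG (s1 ++ hel x :: s2) g t);
  mod_linr : forall s n t, linear (fun x : G n => mG s (hel x) t);
  mod_m1 : forall n (x : G n.+1), mG [::] (hel x) n = cdiff G n x;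
  mod_sum2 : forall x g t, mod_sum [:: x] g t = d1 x *: comp g t;
  mod_sum3 : forall s g t, (2 <= size s)%N -> mod_sum s g t = 0 }.

End Module.

Record Ainf_module (m : Ainf_algebra) (G : complex Q) := {
  mod_op :> seq (helt bar) -> helt G -> forall t, G t;
  mod_ax : Ainf_module_axioms m mod_op }.

End AInfinity.

Section SyzygyComplex.
Context {Q : comPzRingType} {A : complex Q} {unitA : {linear A 0%N -> Q^o}}.
Context {m : Ainf_algebra unitA} {G : complex Q} (mG : Ainf_module m G).
Local Notation bar := (bar A).

Lemma phi_bilinear n t : bilinear_map
  (fun (a : bar n) (g : G 0%N) => mG [:: hel a] (hel g) t).
Proof.
split=> [g|a]; first exact: (mod_lin (mod_ax mG) [::] [::]).
exact: (mod_linr (mod_ax mG)).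
Qed.

(* In degree n = k.+2 the target (G_+[1])_n is G_{k+1}. *)
Definition phi_map n :
    {linear tens bar (G 0%N) n -> shift (plus G) n} :=
  match n return {linear tens bar (G 0%N) n -> shift (plus G) n} with
  | k.+2 => mklin (tlift_linear (phi_bilinear k.+2 k.+1))
  | _ => \0
  end.

Lemma phi_mapC n x : phi_map n (cdiff (tens bar (G 0%N)) n x) =
  cdiff (shift (plus G)) n (phi_map n.+1 x).
Proof.
case: n x => [|[|n]] x; try exact: zeromod_eq.
move: x; apply: tensor_ind => [|a g u IH]; first by rewrite !linear0.
rewrite (linearD (cdiff (tens bar (G 0%N)) n.+2)) (linearD (phi_map n.+2)).
rewrite (linearD (phi_map n.+3)) (linearD (cdiff (shift (plus G)) n.+2)) IH.
congr (_ + _) => {u IH}.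
have -> : cdiff (tens bar (G 0%N)) n.+2 (pure a g) = pure (cdiff bar n.+2 a) g.
  exact: tmapl_pure.
have phiE k (b : bar k.+2) :
    phi_map k.+2 (pure b g) = mG [:: hel b] (hel g) k.+1.
  exact: (tlift_pure (phi_bilinear _ _)).
rewrite !phiE -[RHS]/(- cdiff G n.+1 _).
have := mod_sum2 (mod_ax mG) (hel a) (hel g) n.+1; rewrite scale0r /mod_sum /=.
rewrite (@big_cat_nat _ _ _ 2) //= !big_nat1 /=.
rewrite (@big_cat_nat _ _ _ 1) //= !big_nat1 /=.
rewrite /alg_val /mod_val /deg !big_nil !big_seq1 /= expr0 !scale1r addn0.
rewrite (mod_deg (mod_ax mG) (s := [::]) (t := 0)); last first.
  by rewrite /deg big_nil.
have mG0 : mG [:: hel a] (hel (0 : G 0%N)) n.+1 = 0.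
  have := mod_linr (mod_ax mG) [:: hel a] n.+1 (-1) (0 : G 0%N) 0.
  by rewrite scaler0 addr0 scaleN1r addNr.
rewrite mG0 scaler0 addr0 addn0 (mod_m1 (mod_ax mG)).
rewrite (alg_m1 (alg_ax m)).
by move/eqP; rewrite addr_eq0 => /eqP.
Qed.

(* s m_2^G restricted to A_+[1] (x) G_0 *)
Definition phi : chain_map (tens bar (G 0%N)) (shift (plus G)) :=
  ChainMap phi_mapC.

(* Degree n is (A_+)_n (x) G_0 + G_{n+1}. *)
Definition syz : complex Q := unshift2 (cone phi).

(* For b in A_+[1] and (w, g) in syz_0, this is b (x) dg. *)
Definition syz_corr (s : seq (helt bar)) (x : helt syz) (t : nat) :
    tensor (bar t.+1) (G 0%N) :=
  if s is [:: b] then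
    let: existT n z := x in
    match n return syz n -> tensor (bar t.+1) (G 0%N) with
    | 0 => fun z : tensor (bar 1%N) (G 0%N) * G 1%N =>
             pure (comp b t.+1) (cdiff G 0%N z.2)
    | _ => fun=> 0
    end z
  else 0.

(* The A_oo-module structure on syz.  The maps
     f_n (b_1, ..., b_{n-1}, a (x) g_0) = m_{n+1}^G (b_1, ..., b_{n-1}, a, g_0)
   form an A_oo-morphism A (x) G_0 -> G extending the inclusion of G_0.  The
   part of degree >= 0 of its homotopy fibre is closed under the operations; in
   degree n > 0 it is A_n (x) G_0 + G_{n+1}, and in degree 0 it is, up to sign,
   the graph of g |-> 1 (x) dg on G_1, whence the correction term.  The sign
   (-1)^(|b_1| + ... + |b_{n-1}|) comes from moving the degree shifts past the
   b_i; for n = 1 the formula gives the differential of syz. *)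
Definition syz_op : mod_ops A syz := fun s x t =>
  let: existT n z := x in
  let: (w, g) := (z : tensor (bar n.+1) (G 0%N) * G n.+1) in
  ((-1) ^+ deg s *:
     - tlift (fun (a : bar n.+1) (g0 : G 0%N) =>
                pure (m (rcons s (hel a)) t.+1) g0) w
   + syz_corr s x t,
   (-1) ^+ deg s *:
     (tlift (fun (a : bar n.+1) (g0 : G 0%N) =>
               mG (rcons s (hel a)) (hel g0) t.+1) w
      - mG s (hel g) t.+1))
  : tensor (bar t.+1) (G 0%N) * G t.+1.

End SyzygyComplex.
Arguments syz_op {Q A unitA m G} mG s x t.

(* Main.v *)
Require Import Defs.
From HB Require Import structures.
From mathcomp Require Import all_boot all_algebra.
From mathcomp Require Import boolp functions.

Set Implicit Arguments.
Unset Strict Implicit.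
Unset Printing Implicit Defensive.

Import GRing.Theory.
Local Open Scope ring_scope.

(* The homology of syz.  G_0 is projective, hence flat, so A (x) G_0 is exact
   in positive degrees, with cokernel R (x) G_0 in degree 0.  The relation for
   m_2 says that d m_2(a, g) = d(a) g for a in A_1 and g in G_0: up to the
   boundary of G_1, the map m_2 lifts A_1 (x) G_0 -> A_0 (x) G_0 = G_0.  Hence a
   cycle (w, g) of positive degree has w a boundary of A (x) G_0, and what is
   left of it is a cycle of G; and g in G_1 has 1 (x) dg = 0 in R (x) G_0 iff dg
   is the boundary of some m_2(w).  The augmentation is g |-> 1 (x) dg.

   The A_oo-relations.  On the summand G the relation for syz is that of m^G
   without the terms in which m_1 sends G_1 to G_0, and these are restored by
   the correction term of the operations; on A (x) G_0 it combines the relations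
   of m and of m^G for the words s, a and s, a, g; for s = b the extra term
   (d_1 a) b (x) g is again cancelled by the correction term. *)

(** * Linear maps and tensors *)

Section LinearFacts.
Context {Q : comPzRingType}.

Lemma linear_fun0 (U V : lmodType Q) (f : U -> V) : linear f -> f 0 = 0.
Proof. by move=> f_lin; apply: (linear0 (mklin f_lin)). Qed.

Lemma linear_funD (U V : lmodType Q) (f : U -> V) :
  linear f -> {morph f : x y / x + y}.
Proof. by move=> f_lin x y; apply: (linearD (mklin f_lin)). Qed.

Lemma linear_funZ (U V : lmodType Q) (f : U -> V) :
  linear f -> forall c x, f (c *: x) = c *: f x.
Proof. by move=> f_lin c x; apply: (linearZ_LR (mklin f_lin)). Qed.

Context {M N : lmodType Q}.
Implicit Types (x : M) (y : N).

Lemma pure0l y : pure (0 : M) y = 0.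
Proof. exact: (linear_fun0 ((pure_bilinear M N).1 y)). Qed.

Lemma pure0r x : pure x (0 : N) = 0.
Proof. exact: (linear_fun0 ((pure_bilinear M N).2 x)). Qed.

Lemma pureDl y : {morph (fun x : M => pure x y) : x x' / x + x'}.
Proof. exact: (linear_funD ((pure_bilinear M N).1 y)). Qed.

Lemma pureZl c x y : pure (c *: x) y = c *: pure x y.
Proof. exact: (linear_funZ ((pure_bilinear M N).1 y)). Qed.

Lemma pureDr x : {morph (fun y : N => pure x y) : y y' / y + y'}.
Proof. exact: (linear_funD ((pure_bilinear M N).2 x)). Qed.

Lemma pureZr c x y : pure x (c *: y) = c *: pure x y.
Proof. exact: (linear_funZ ((pure_bilinear M N).2 x)). Qed.

Lemma pure_sumr (I : Type) (r : seq I) (F : I -> N) x :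
  pure x (\sum_(i <- r) F i) = \sum_(i <- r) pure x (F i).
Proof. exact: (big_morph _ (pureDr x) (pure0r x)). Qed.

Lemma tensor_linear_eq (P : lmodType Q) (f g : {linear tensor M N -> P}) :
  (forall x y, f (pure x y) = g (pure x y)) -> forall u, f u = g u.
Proof.
move=> fg; apply: tensor_ind => [|x y u IH]; first by rewrite !linear0.
by rewrite !linearD IH fg.
Qed.

(** [tlift] bundled as a linear map, so that [linearD], [linear0] and [linearZ] apply to it. *)
Definition blift (P : lmodType Q) (b : M -> N -> P) (b_bil : bilinear_map b) :
    {linear tensor M N -> P} := mklin (tlift_linear b_bil).

Lemma blift_pure (P : lmodType Q) (b : M -> N -> P) (b_bil : bilinear_map b)
  x y : blift b_bil (pure x y) = b x y.
Proof. exact: (tlift_pure b_bil). Qed.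

End LinearFacts.

(** * Projective modules are closed under tensor products, and flat *)

Section Hom.
Context {Q : comPzRingType} (U V : lmodType Q).

Definition hom_pred : {pred U -> V} := fun f => `[< linear f >].

Fact hom_pred_submod : submod_closed hom_pred.
Proof.
split=> [|c f g].
  by apply/asboolP => a x y; rewrite [LHS](_ : _ = 0) // scaler0 addr0.
move=> /asboolP f_lin /asboolP g_lin; apply/asboolP => a x y.
rewrite -[LHS]/(c *: f _ + g _) f_lin g_lin.
rewrite -[RHS]/(a *: (c *: f x + g x) + (c *: f y + g y)).
by rewrite !scalerDr !scalerA mulrC addrACA.
Qed.

HB.instance Definition _ :=
  GRing.isSubmodClosed.Build Q (U -> V) hom_pred hom_pred_submod.

(** The module Hom(U, V), cut out of the module of all functions [U -> V]; it serves as the target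
    of currying. *)
Record hom : Type := Hom { hom_val : U -> V; _ : hom_val \in hom_pred }.

HB.instance Definition _ := [isSub for hom_val].
HB.instance Definition _ := [Choice of hom by <:].
HB.instance Definition _ := [SubChoice_isSubLmodule of hom by <:].

Lemma hom_linear (f : hom) : linear (hom_val f).
Proof. by case: f => f /= /asboolP. Qed.

Definition to_hom (f : U -> V) (f_lin : linear f) : hom :=
  Hom (introT (asboolP _) f_lin).

End Hom.

Lemma postcomp_linear (Q : comPzRingType) (N U V : lmodType Q)
    (p : {linear U -> V}) (f : hom N U) :
  linear (fun x => p (hom_val f x)).
Proof. by move=> c x y; rewrite hom_linear linearP. Qed.

Lemma postcomp_hom_linear (Q : comPzRingType) (N U V : lmodType Q)
    (p : {linear U -> V}) :
  linear (fun f : hom N U => to_hom (postcomp_linear p f)).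
Proof.
move=> c f g; apply: val_inj; apply/funext => x.
exact: (linearP p).
Qed.

Lemma curry_linear (Q : comPzRingType) (P N V : lmodType Q)
    (f : {linear tensor P N -> V}) x : linear (fun y => f (pure x y)).
Proof. by move=> c y y'; rewrite pureDr pureZr linearP. Qed.

Lemma curry_hom_linear (Q : comPzRingType) (P N V : lmodType Q)
    (f : {linear tensor P N -> V}) :
  linear (fun x => to_hom (curry_linear f x)).
Proof.
move=> c x x'; apply: val_inj; apply/funext => y.
by rewrite -[LHS]/(f (pure (c *: x + x') y)) pureDl pureZl linearP.
Qed.

(* By the adjunction Hom(P (x) N, -) = Hom(P, Hom(N, -)). *)
Lemma projective_tensor (Q : comPzRingType) (P N : lmodType Q) :
  projective P -> projective N -> projective (tensor P N).
Proof.
move=> projP projN U V p f p_surj.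
have [|g gE] := projP _ _ (mklin (postcomp_hom_linear (N := N) p))
  (mklin (curry_hom_linear f)).
  (* Composition with [p] is onto on Hom(N, -) because N is projective. *)
  move=> h; have [k kE] := projN _ _ p (mklin (hom_linear h)) p_surj.
  have k_lin : linear k by move=> c x y; rewrite linearP.
  by exists (to_hom k_lin); apply: val_inj; apply/funext => y; apply: kE.
have bil : bilinear_map (fun x y => hom_val (g x) y).
  by split=> [y c x x'|x]; [rewrite linearP|apply: hom_linear].
exists (blift bil) => u.
have -> : p (blift bil u) = (p \o blift bil : {linear tensor P N -> V}) u by [].
apply: tensor_linear_eq => x y; rewrite /= -[LHS]/(p (blift bil _)) blift_pure.
exact: (congr1 (fun h => hom_val h y) (gE x)).
Qed.

Lemma projective_pair (Q : comPzRingType) (P N : lmodType Q) :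
  projective P -> projective N -> projective (P * N)%type.
Proof.
move=> projP projN U V p f p_surj.
have l1 : linear (fun x : P => f (x, 0)).
  move=> c x y; rewrite -linearP; congr (f _).
  by apply: injective_projections; rewrite //= scaler0 addr0.
have l2 : linear (fun y : N => f (0, y)).
  move=> c x y; rewrite -linearP; congr (f _).
  by apply: injective_projections; rewrite //= scaler0 addr0.
have [g1 g1E] := projP _ _ p (mklin l1) p_surj.
have [g2 g2E] := projN _ _ p (mklin l2) p_surj.
have gl : linear (fun z : P * N => g1 z.1 + g2 z.2).
  by move=> c z z'; rewrite !linearP scalerDr addrACA.
exists (mklin gl) => -[x y]; rewrite /= linearD g1E g2E /= -linearD.
by congr (f _); apply: injective_projections; rewrite /= ?addr0 ?add0r.
Qed.

Lemma projective_zeromod (Q : comPzRingType) : projective (zeromod (Q := Q)).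
Proof.
move=> U V p f _; exists \0 => x.
by rewrite linear0 [x](zeromod_eq x 0) linear0.
Qed.

(** * Free modules, dual bases and flatness *)

Section Free.
Context {Q : comPzRingType} (N : lmodType Q).

Definition fin_supp (f : N -> Q^o) : Prop :=
  exists s : seq N, forall x, x \notin s -> f x = 0.

Definition free_pred : {pred N -> Q^o} := fun f => `[< fin_supp f >].

Fact free_pred_submod : submod_closed free_pred.
Proof.
split=> [|c f g]; first by apply/asboolP; exists [::].
move=> /asboolP[s fs] /asboolP[t gt]; apply/asboolP; exists (s ++ t) => x.
rewrite mem_cat negb_or => /andP[xs xt].
by rewrite -[LHS]/(c *: f x + g x) fs // gt // scaler0 addr0.
Qed.

HB.instance Definition _ :=
  GRing.isSubmodClosed.Build Q (N -> Q^o) free_pred free_pred_submod.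

(** This is the free module on the set N, mapped onto N by [free_eval]; a projective N splits that
    map. *)
Record free_mod : Type :=
  FreeMod { coeff : N -> Q^o; _ : coeff \in free_pred }.

HB.instance Definition _ := [isSub for coeff].
HB.instance Definition _ := [Choice of free_mod by <:].
HB.instance Definition _ := [SubChoice_isSubLmodule of free_mod by <:].

Lemma coeff_supp (f : free_mod) : fin_supp (coeff f).
Proof. by case: f => f /= /asboolP. Qed.

(** A chosen list containing the support, possibly larger than it. Hence [free_evalE], which lets
    several elements be evaluated over one common list. *)
Definition supp (f : free_mod) : seq N := undup (projT1 (cid (coeff_supp f))).

Lemma supp_out f x : x \notin supp f -> coeff f x = 0.
Proof. by rewrite mem_undup; apply: (projT2 (cid (coeff_supp f))). Qed.

Definition free_eval (f : free_mod) : N := \sum_(x <- supp f) coeff f x *: x.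

Lemma free_evalE f s :
  uniq s -> {subset supp f <= s} -> free_eval f = \sum_(x <- s) coeff f x *: x.
Proof.
move=> s_uniq fs; rewrite /free_eval [RHS](bigID (mem (supp f))) /=.
rewrite [X in _ + X]big1 ?addr0 => [|x /supp_out ->]; last exact: scale0r.
rewrite -[RHS]big_filter; apply: perm_big; apply: uniq_perm => [||x].
- exact: undup_uniq.
- exact: filter_uniq.
by rewrite mem_filter; case: (boolP (x \in supp f)) => //= /fs ->.
Qed.

Lemma free_eval_linear : linear free_eval.
Proof.
move=> c f g; pose s := undup (supp (c *: f + g) ++ supp f ++ supp g).
have su : uniq s by apply: undup_uniq.
rewrite !(@free_evalE _ s) // => [|x xs|x xs|x xs];
  rewrite ?mem_undup ?mem_cat ?xs ?orbT //.
rewrite scaler_sumr -big_split; apply: eq_bigr => x _ /=.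
by rewrite scalerA -scalerDl.
Qed.

Lemma delta_fin_supp (x : N) : fin_supp (fun y => (y == x)%:R).
Proof. by exists [:: x] => y; rewrite inE => /negPf->. Qed.

Definition free_delta (x : N) : free_mod :=
  FreeMod (introT (asboolP _) (delta_fin_supp x)).

Lemma free_eval_delta x : free_eval (free_delta x) = x.
Proof.
rewrite (@free_evalE _ (undup (x :: supp (free_delta x)))) ?undup_uniq //.
  rewrite (bigD1_seq x) ?undup_uniq ?mem_undup ?mem_head //= eqxx scale1r.
  by rewrite big1 ?addr0 // => y /negPf->; rewrite scale0r.
by move=> y ys; rewrite mem_undup inE ys orbT.
Qed.

(* The dual basis lemma: the functionals l_y, for y in N, satisfy
   x = \sum_y l_y(x) y. *)
Lemma dual_basis : projective N ->
  exists l : N -> {linear N -> Q^o}, forall xs : seq N, exists2 s : seq N,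
    uniq s & forall x, x \in xs -> x = \sum_(y <- s) l y x *: y.
Proof.
move=> projN.
have idl : linear (fun x : N => x) by [].
(* [g] is a section of [free_eval]; l_y(x) will be the coefficient of g(x) at y. *)
have [|g gE] := projN _ _ (mklin free_eval_linear) (mklin idl).
  by move=> x; exists (free_delta x); apply: free_eval_delta.
have ll y : linear (fun x => coeff (g x) y).
  by move=> c x x'; rewrite linearP.
exists (fun y => mklin (ll y)) => xs.
exists (undup (flatten [seq supp (g x) | x <- xs])) => [|x x_xs].
  exact: undup_uniq.
rewrite -{1}[x](gE x); apply: free_evalE; first exact: undup_uniq.
move=> y y_in; rewrite mem_undup; apply/flattenP.
by exists (supp (g x)) => //; apply: map_f.
Qed.

End Free.

(** The functionals of a dual basis give coordinates V (x) N -> V, natural in V, and w is the sum of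
    its coordinates tensored with the y's. If w dies in W (x) N, each coordinate dies in W, hence
    lifts to U. *)
Lemma projective_flat (Q : comPzRingType) (U V W N : lmodType Q)
    (f : {linear U -> V}) (g : {linear V -> W}) :
  projective N -> (forall v, g v = 0 -> exists u, f u = v) ->
  forall w, tmapl N g w = 0 -> exists u, tmapl N f u = w.
Proof.
move=> projN fg_exact; have [l lP] := dual_basis projN.
have coord_bil (V' : lmodType Q) y :
    bilinear_map (fun (v : V') (x : N) => l y x *: v).
  split=> [x c v v'|v c x x'].
    by rewrite scalerDr !scalerA mulrC.
  by rewrite linearP scalerDl -scalerA.
pose coord (V' : lmodType Q) y := blift (coord_bil V' y).
have coordC y w : g (coord V y w) = coord W y (tmapl N g w).
  elim/(@tensor_ind Q V N): w => [|v x u IH]; first by rewrite !linear0.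
  rewrite (linearD (coord V y)) (linearD (tmapl N g)) !linearD IH tmapl_pure.
  by rewrite !blift_pure linearZ.
have expand (w : tensor V N) :
    exists s : seq N, w = \sum_(y <- s) pure (coord V y w) y.
  (* One list s must expand all second factors of w at once, so the induction on w only collects
     these factors and leaves s arbitrary. *)
  suff [xs xsP] : exists xs : seq N, forall s : seq N,
      (forall x, x \in xs -> x = \sum_(y <- s) l y x *: y) ->
      w = \sum_(y <- s) pure (coord V y w) y.
    by have [s _ /xsP sP] := lP xs; exists s.
  elim/(@tensor_ind Q V N): w => [|v x u [xs IH]].
    exists [::] => s _; rewrite big1 // => y _.
    by rewrite linear0 pure0l.
  have E y : coord V y (pure v x + u) = l y x *: v + coord V y u.
    by rewrite linearD blift_pure.
  exists (x :: xs) => s sP.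
  rewrite [RHS](eq_bigr (fun y => pure v (l y x *: y) + pure (coord V y u) y));
    last by move=> y _; rewrite E pureDl pureZl pureZr.
  rewrite {1}(IH s) => [|z z_xs]; last by apply: sP; rewrite inE z_xs orbT.
  by rewrite {1}[x]sP ?mem_head // pure_sumr -big_split.
move=> w w0; have [s ->] := expand w.
have lift y : exists u, f u = coord V y w.
  by apply: fg_exact; rewrite coordC w0 linear0.
exists (\sum_(y <- s) pure (projT1 (cid (lift y))) y).
rewrite linear_sum; apply: eq_bigr => y _.
by rewrite tmapl_pure (projT2 (cid (lift y))).
Qed.

Lemma zeromod_tensor_eq0 (Q : comPzRingType) (N : lmodType Q)
  (w : tensor (zeromod (Q := Q)) N) : w = 0.
Proof.
elim/(@tensor_ind Q): w => // x y u ->.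
by rewrite [x](zeromod_eq x 0) pure0l addr0.
Qed.

Lemma comp_hel (Q : comPzRingType) (X : complex Q) n (x : X n) :
  Defs.comp (hel x) n = x.
Proof. exact: (@tagged_asE _ (fun n => X n) (hel (0 : X n)) x). Qed.

Section ModuleFacts.
Context {Q : comPzRingType} {A : complex Q} {unitA : {linear A 0%N -> Q^o}}.
Context {m : Ainf_algebra unitA} {G : complex Q} (mG : Ainf_module m G).
Local Notation bar := (bar A).

Lemma mod_linr0 s n t : mG s (hel (0 : G n)) t = 0.
Proof. exact: (linear_fun0 (mod_linr (mod_ax mG) s (n := n) t)). Qed.

(** For n = 2 this is the relation for m_2 in degree 0: the two other terms contain m_1(a), in the
    zero module (A_+[1])_1, or m_1(g) with g of degree 0. For other n both sides vanish for degree
    reasons. *)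
Lemma cdiff_mod2 n (a : bar n) (g : G 0%N) :
  cdiff G 0%N (mG [:: hel a] (hel g) 1%N) = d1 unitA (hel a) *: g.
Proof.
have [n2|n2] := eqVneq n 2%N; last first.
  rewrite (mod_deg (mod_ax mG)); last first.
    by rewrite /deg big_seq1 /= addn0 eq_sym.
  by rewrite linear0; case: n a n2 => [|[|[|n]]] a //= _; rewrite scale0r.
subst n.
have := mod_sum2 (mod_ax mG) (hel a) (hel g) 0; rewrite comp_hel => <-.
rewrite /mod_sum /=.
rewrite (@big_cat_nat _ _ _ 2) //= !big_nat1 /=.
rewrite (@big_cat_nat _ _ _ 1) //= !big_nat1 /=.
rewrite /alg_val /mod_val /deg !big_nil !big_seq1 /= expr0 !scale1r.
(* The value m_1(g) carries the truncated degree 0.-1 = 0 and is zero. *)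
rewrite (mod_deg (mod_ax mG) (s := [::]) (g := hel g) (t := 0)); last first.
  by rewrite /deg big_nil.
rewrite mod_linr0 scaler0 !addr0.
rewrite (mod_m1 (mod_ax mG)) (zeromod_eq (m [:: hel a] 1%N) 0).
rewrite (linear_fun0 (mod_lin (mod_ax mG) [::] [::] (hel g) (n := 1) 0)).
by rewrite add0r.
Qed.

End ModuleFacts.

(** * The resolution of the syzygy *)

Section Resolution.
Context {Q R : comPzRingType} (pi : {rmorphism Q -> R}).
Hypothesis pi_surj : forall r : R, exists q : Q, pi q = r.
Context {M : lmodType R}.
Context {A : complex Q} {unitA : {linear A 0%N -> Q^o}}.
Hypothesis unitA_bij : bijective unitA.
Context {epsA : chain_map A (stalk (restr pi R^o))}.
Hypothesis resA : resolution epsA.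
Context {m : Ainf_algebra unitA} {G : complex Q}.
Context {epsG : chain_map G (stalk (restr pi M))}.
Hypothesis resG : resolution epsG.
Variable mG : Ainf_module m G.

Local Notation bar := (bar A).
Local Notation G0 := (G 0%N).

Lemma resolution_exact (X : complex Q) (N : lmodType Q)
    (f : chain_map X (stalk N)) : resolution f ->
  forall n (x : X n.+1), cdiff X n x = 0 -> exists y, cdiff X n.+1 y = x.
Proof.
move=> [_ qf] n x dx; have [inj _] := qf n.+1.
by apply: inj => //; exists 0; apply: zeromod_eq.
Qed.

Lemma resolution_exact0 (X : complex Q) (N : lmodType Q)
    (f : chain_map X (stalk N)) : resolution f ->
  forall x : X 0%N, f 0%N x = 0 -> exists y, cdiff X 0%N y = x.
Proof.
move=> [_ qf] x fx; have [inj _] := qf 0%N.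
by apply: inj => //; exists 0; rewrite fx.
Qed.

Lemma augmentation_cdiff (X : complex Q) (N : lmodType Q)
  (f : chain_map X (stalk N)) x : f 0%N (cdiff X 0%N x) = 0.
Proof. by rewrite cmapC. Qed.

Lemma augmentation_surj (X : complex Q) (N : lmodType Q)
    (f : chain_map X (stalk N)) : resolution f ->
  forall y, exists x, f 0%N x = y.
Proof.
move=> [_ qf] y; have [_ surj] := qf 0%N.
have [x _ [z /= zE]] := surj y I; exists x.
by apply/eqP; rewrite -subr_eq0 -zE.
Qed.

Lemma unitA_inv : exists e : A 0%N, forall a, a = unitA a *: e.
Proof.
have [inv invK unitK] := unitA_bij; exists (inv 1) => a.
by apply: (can_inj invK); rewrite linearZ /= unitK [_ *: _]mulr1.
Qed.

(** [epsA] may send the generator [e] of A_0 to an element other than 1, but [epsA] is onto, so that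
    element is invertible in R and can be cancelled from [epsA (d a) = 0]. *)
Lemma pi_unitA_cdiff (a : A 1%N) : pi (unitA (cdiff A 0%N a)) = 0.
Proof.
have [e eE] := unitA_inv.
have epsE b : epsA 0%N b = pi (unitA b) * (epsA 0%N e : R) :> R.
  by rewrite {1}[b]eE linearZ.
have [u] := augmentation_surj resA (1 : R^o); rewrite epsE => u1.
have := augmentation_cdiff epsA a; rewrite epsE => d0.
rewrite -[LHS]mulr1 -u1 mulrCA d0.
exact: mulr0.
Qed.

Lemma unit_action_bilinear :
  bilinear_map (fun (a : A 0%N) (g : G0) => unitA a *: g).
Proof.
split=> [g c a b|a c g h]; first by rewrite linearP scalerDl -scalerA.
by rewrite scalerDr !scalerA mulrC.
Qed.

(** The action A_0 (x) G_0 -> G_0 has the left inverse g |-> e (x) g, with [e] the generator of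
    A_0. *)
Lemma tensor_unitA_inj (w : tensor (A 0%N) G0) :
  blift unit_action_bilinear w = 0 -> w = 0.
Proof.
have [e eE] := unitA_inv => w0.
have l : linear (fun g : G0 => pure e g) := (pure_bilinear _ _).2 e.
suff -> : w = (mklin l \o blift unit_action_bilinear :
    {linear tensor (A 0%N) G0 -> tensor (A 0%N) G0}) w.
  by rewrite /= -[tlift _ _]/(blift unit_action_bilinear w) w0 pure0r.
have idl : linear (fun u : tensor (A 0%N) G0 => u) by [].
rewrite -[LHS]/(mklin idl w); apply: tensor_linear_eq => a g.
rewrite -[RHS]/(pure e (blift unit_action_bilinear (pure a g))) blift_pure.
by rewrite pureZr -pureZl -eE.
Qed.

(* m_2^G on A_{n+1} (x) G_0 *)
Definition mu n : {linear tensor (bar n.+2) G0 -> G n.+1} :=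
  blift (phi_bilinear mG n.+2 n.+1).

Lemma cdiff_mu0 w : cdiff G 0%N (mu 0 w) =
  blift unit_action_bilinear (tmapl G0 (cdiff A 0%N) w).
Proof.
elim/(@tensor_ind Q): w => [|a g w IH]; first by rewrite !linear0.
rewrite (linearD (mu 0)) (linearD (tmapl _ _)) 2!linearD IH tmapl_pure.
by rewrite /mu !blift_pure cdiff_mod2.
Qed.

(** This is the compatibility of [phi] with the differentials; the sign is that of the differential
    of G_+[1]. *)
Lemma cdiff_mu n w : cdiff G n.+1 (mu n.+1 w) =
  - mu n (tmapl G0 (cdiff bar n.+2) w).
Proof.
have := phi_mapC mG (n := n.+2) w.
by move=> H; rewrite -[RHS]/(- phi_map mG n.+2 _) H /= opprK.
Qed.

Lemma projective_syz n : projective (syz mG n).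
Proof.
case: resA => projA _; case: resG => projG _.
apply: projective_pair; last exact: projG.
apply: projective_tensor; last exact: projG.
by case: n => [|n]; [apply: projective_zeromod|apply: projA].
Qed.

(** * The augmentation onto the syzygy *)

Local Notation Omega := (syzygy (epsG 0%N)).

Lemma syz_augP (g : G 1%N) :
  (pure (1 : restr pi R^o) (cdiff G 0%N g) : base_ext pi G0)
    \in syz_pred (epsG 0%N).
Proof.
rewrite unfold_in /base_ev (tlift_pure (base_ev_bilinear (epsG 0%N))).
by rewrite augmentation_cdiff; apply/eqP/scaler0.
Qed.

Definition syz_aug0 (z : syz mG 0%N) : restr pi Omega := Syzygy (syz_augP z.2).

Lemma syz_aug0_linear : linear syz_aug0.
Proof.
move=> c z z'; apply: (val_inj (sT := Omega)).
pose one_tens y := pure (1 : restr pi R^o) (y : G0).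
rewrite -[RHS]/(base_scale (pi c)
    (one_tens (cdiff G 0%N z.2) : base_ext pi G0) +
  one_tens (cdiff G 0%N z'.2)).
rewrite -[LHS]/(one_tens (cdiff G 0%N (c *: z.2 + z'.2))) /one_tens.
rewrite linearP pureDr pureZr base_scale_pure; congr (_ + _).
by rewrite -pureZl.
Qed.

Definition syz_aug_map n : {linear syz mG n -> stalk (restr pi Omega) n} :=
  match n with 0 => mklin syz_aug0_linear | _ => \0 end.

(** The scalars unitA(d a) move across the tensor sign and act as zero on R. Thus the augmentation
    kills the boundaries coming from [mu]. *)
Lemma pure1_eq0 (w : tensor (A 1%N) G0) :
  pure (1 : restr pi R^o)
    (blift unit_action_bilinear (tmapl G0 (cdiff A 0%N) w)) = 0.
Proof.
elim/(@tensor_ind Q): w => [|a g w IH]; first by rewrite !linear0 pure0r.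
rewrite (linearD (tmapl _ _)) linearD pureDr IH addr0 tmapl_pure blift_pure.
rewrite pureZr -pureZl -[_ *: (1 : restr pi R^o)]/(pi _ * 1).
by rewrite pi_unitA_cdiff mul0r pure0l.
Qed.

Lemma syz_aug_mapC n x : syz_aug_map n (cdiff (syz mG) n x) =
  cdiff (stalk (restr pi Omega)) n (syz_aug_map n.+1 x).
Proof.
case: n x => [|n] [w g]; last exact: zeromod_eq.
apply: (val_inj (sT := Omega)).
rewrite -[LHS]/(pure (1 : restr pi R^o) (cdiff G 0%N (mu 0 w - cdiff G 1%N g))).
by rewrite linearB cdiffK subr0 cdiff_mu0 pure1_eq0.
Qed.

Definition syz_aug : chain_map (syz mG) (stalk (restr pi Omega)) :=
  ChainMap syz_aug_mapC.

(** * Exactness of the augmented complex *)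

Lemma syz_cdiffE n (w : tensor (bar n.+2) G0) (g : G n.+2) :
  cdiff (syz mG) n (w, g) =
    (- tmapl G0 (cdiff bar n.+1) w, mu n w - cdiff G n.+1 g).
Proof. by []. Qed.

(** Flatness of G_0 is applied to A_1 -> A_0 -> R and to the element [inv 1] (x) y, whose image in R
    (x) G_0 is q times 1 (x) y, where [pi q] is the value of [epsA] at [inv 1]. *)
Lemma pure1_exact (y : G0) : pure (1 : restr pi R^o) y = 0 ->
  exists w : tensor (A 1%N) G0,
    y = blift unit_action_bilinear (tmapl G0 (cdiff A 0%N) w).
Proof.
move=> y0; have [inv invK unitK] := unitA_bij.
have [q qE] := pi_surj (epsA 0%N (inv 1)).
have [||w wE] := @projective_flat _ _ _ _ _ (cdiff A 0%N) (epsA 0%N)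
  (resG.1 0%N) _ (pure (inv 1) y).
- exact: (resolution_exact0 resA).
- rewrite tmapl_pure -qE -[pi q]mulr1 -[pi q * 1]/(q *: (1 : restr pi R^o)).
  by rewrite pureZl y0 scaler0.
by exists w; rewrite wE blift_pure unitK scale1r.
Qed.

Lemma restr_tensor_pure (u : tensor (restr pi R^o) G0) :
  exists y, u = pure (1 : restr pi R^o) y.
Proof.
elim/(@tensor_ind Q): u => [|r g u [y ->]]; first by exists 0; rewrite pure0r.
have [q <-] := pi_surj r; exists (q *: g + y).
by rewrite pureDr pureZr -pureZl -[_ *: (1 : restr pi R^o)]/(pi _ * 1) mulr1.
Qed.

Lemma bar_exact n (a : A n.+1) :
    (cdiff A n a = 0 -> exists b, cdiff A n.+1 b = a) ->
  cdiff A n a = 0 -> exists b, cdiff bar n.+2 b = a.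
Proof.
by move=> ex /ex[b <-]; exists (- b); rewrite linearN /= opprK.
Qed.

Lemma syz_exact n (z : syz mG n.+1) :
  cdiff (syz mG) n z = 0 -> exists y, cdiff (syz mG) n.+1 y = z.
Proof.
case: z => w g; rewrite syz_cdiffE => dz.
have dw : tmapl G0 (cdiff bar n.+1) w = 0.
  by apply/eqP; rewrite -oppr_eq0; apply/eqP; apply: (congr1 fst dz).
have /eqP : mu n w - cdiff G n.+1 g = 0 := congr1 snd dz.
rewrite subr_eq0 => /eqP dg {dz}.
have [v vE] : exists v, tmapl G0 (cdiff bar n.+2) v = w.
  (* The differential of A_+[1] is zero on A_1. There w is a cycle of A (x) G_0 for another reason:
     mu w = dg, and d mu w is the image of w in A_0 (x) G_0 = G_0. *)
  case: n w g dw dg => [|n] w g dw dg.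
    apply: (projective_flat (g := cdiff A 0%N) (resG.1 0%N)).
      exact: (fun a => bar_exact (@resolution_exact _ _ _ resA 0 a)).
    by apply: tensor_unitA_inj; rewrite -cdiff_mu0 dg cdiffK.
  apply: (projective_flat (g := cdiff bar n.+2) (resG.1 0%N)) dw => a.
  move/eqP; rewrite /= oppr_eq0 => /eqP.
  exact: (bar_exact (@resolution_exact _ _ _ resA n.+1 a)).
(* The right-hand side is a cycle: d mu(-v) = mu w = dg. The sign of v undoes the one in
   [syz_cdiffE]. *)
have [h hE] : exists h, cdiff G n.+2 h = mu n.+1 (- v) - g.
  apply: (resolution_exact resG).
  by rewrite linearB cdiff_mu linearN vE linearN opprK dg subrr.
exists (- v, h); rewrite syz_cdiffE hE linearN opprK vE.
by rewrite opprB addrC subrK.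
Qed.

Lemma syz_aug_inj (z : syz mG 0%N) :
  syz_aug 0%N z = 0 -> exists y, cdiff (syz mG) 0%N y = z.
Proof.
case: z => w g /(congr1 val) z0.
have [v vE] := pure1_exact z0.
have [h hE] : exists h, cdiff G 1%N h = mu 0 v - g.
  by apply: (resolution_exact resG); rewrite linearB cdiff_mu0 -vE subrr.
exists (v, h); rewrite syz_cdiffE hE opprB addrC subrK.
by congr (_, _); rewrite (zeromod_tensor_eq0 w) (zeromod_tensor_eq0 (- _)).
Qed.

Lemma syz_aug_surj (y : Omega) : exists z, syz_aug 0%N z = y.
Proof.
case: y => u u_syz; have [x xE] := restr_tensor_pure u.
have : epsG 0%N x = 0.
  move: (u_syz); rewrite xE unfold_in /base_ev.
  rewrite (tlift_pure (base_ev_bilinear (epsG 0%N))) scale1r.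
  exact/eqP.
move=> /(resolution_exact0 resG)[g gE].
exists (0, g); apply: (val_inj (sT := Omega)).
by rewrite /= gE xE.
Qed.

Lemma syz_aug_resolution : resolution syz_aug.
Proof.
split=> [|[|n]]; first exact: projective_syz.
  split=> [z _ [y yE]|y _]; first by apply: syz_aug_inj; rewrite -yE.
  have [z zE] := syz_aug_surj y; exists z => //.
  by exists 0; rewrite zE subrr linear0.
split=> [z dz _|y _]; first exact: syz_exact.
exists 0; first exact: linear0.
by exists 0; apply: zeromod_eq.
Qed.

End Resolution.

(** * The A_oo-relations *)

Section HomogeneousElements.
Context {Q : comPzRingType}.
Implicit Type X : complex Q.

Lemma comp_neq X n (x : X n) t : t != n -> Defs.comp (hel x) t = 0.
Proof.
by rewrite /Defs.comp /tagged_as /=; case: eqP => // ->; rewrite eqxx.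
Qed.

Lemma comp_linear X n t : linear (fun x : X n => Defs.comp (hel x) t).
Proof.
move=> c x y; have [->|tn] := eqVneq t n; first by rewrite !comp_hel.
by rewrite !comp_neq // scaler0 addr0.
Qed.

Lemma hel_comp X (x : helt X) : hel (Defs.comp x (tag x)) = x.
Proof. by case: x => n x; rewrite -[existT _ n x]/(hel x) comp_hel. Qed.

(** A map of degree -1 has its value in degree d - 1 alone, so tagging that component loses nothing;
    for d = 0 the truncated tag 0 carries the value 0. *)
Lemma comp_val X (F : forall t, X t) d t :
  (forall i, i.+1 != d -> F i = 0) -> Defs.comp (hel (F d.-1)) t = F t.
Proof.
move=> F0; have [->|tn] := eqVneq t d.-1; first by rewrite comp_hel.
by rewrite comp_neq // F0 //; apply: contra tn => /eqP<-.
Qed.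

Lemma deg_nil X : deg ([::] : seq (helt X)) = 0%N.
Proof. by rewrite /deg big_nil. Qed.

Lemma deg_cons X (x : helt X) s : deg (x :: s) = (tag x + deg s)%N.
Proof. by rewrite /deg big_cons. Qed.

Lemma deg_cat X (s s' : seq (helt X)) : deg (s ++ s') = (deg s + deg s')%N.
Proof. by rewrite /deg big_cat. Qed.

Lemma deg_rcons X (s : seq (helt X)) x : deg (rcons s x) = (deg s + tag x)%N.
Proof. by rewrite -cats1 deg_cat deg_cons deg_nil addn0. Qed.

Definition sgn X (s : seq (helt X)) : Q := (-1) ^+ deg s.

Lemma sgn_nil X : sgn ([::] : seq (helt X)) = 1.
Proof. by rewrite /sgn deg_nil. Qed.

Lemma sgn_cat X (s s' : seq (helt X)) : sgn (s ++ s') = sgn s * sgn s'.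
Proof. by rewrite /sgn deg_cat exprD. Qed.

Lemma sgn_sqr X (s : seq (helt X)) : sgn s * sgn s = 1.
Proof. by rewrite /sgn -expr2 sqrr_sign. Qed.

End HomogeneousElements.

Lemma take_rcons_le (T : Type) (s : seq T) x k :
  (k <= size s)%N -> take k (rcons s x) = take k s.
Proof. by move=> ks; rewrite -cats1 takel_cat. Qed.

(** * Summation over inner operations *)

Section Sums.
Context {Q : comPzRingType} {A : complex Q} (m : alg_ops A).
Local Notation bar := (bar A).
Local Notation word := (seq (helt bar)).
Implicit Types (s : word) (V W : lmodType Q).

(* In an A_oo-relation whose variables are s followed by one more, inner
   collects the terms whose inner operation stays within s, and outer those
   whose inner operation reaches the last variable. *)
Definition inner V s (F : word -> V) : V :=
  \sum_(1 <= i < (size s).+1) \sum_(0 <= j < (size s - i).+1)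
    sgn (take j s) *:
      F (take j s ++ alg_val m (take i (drop j s)) :: drop (j + i) s).

Definition outer V s (F : word -> word -> V) : V :=
  \sum_(0 <= j < (size s).+1) sgn (take j s) *: F (take j s) (drop j s).

(** Splits the diagonal i + j = k + 1 off the triangle i + j <= k + 1; on it the inner operation
    reaches the last variable. *)
Lemma triangle_sum V k (X : nat -> nat -> V) :
  \sum_(1 <= i < k.+2) \sum_(0 <= j < (k.+1 - i).+1) X i j =
  \sum_(1 <= i < k.+1) \sum_(0 <= j < (k - i).+1) X i j +
  \sum_(0 <= j < k.+1) X (k.+1 - j)%N j.
Proof.
under eq_bigr do rewrite big_nat_recr //=.
rewrite big_split /=; congr (_ + _).
  rewrite big_nat_recr //= subnn [X in _ + X]big_geq // addr0.
  by apply: eq_big_nat => i /andP[_ ik]; rewrite subSn.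
rewrite big_add1 big_nat_rev /=; apply: eq_big_nat => i /andP[_ ik].
by rewrite add0n subSS -subSn // subKn // ltnW.
Qed.

Lemma inner_rcons V s a (F : word -> V) :
  inner (rcons s a) F = inner s (fun s' => F (rcons s' a)) +
    outer s (fun s1 s2 => F (rcons s1 (alg_val m (rcons s2 a)))).
Proof.
rewrite {1}/inner size_rcons triangle_sum; congr (_ + _).
  apply: eq_big_nat => i /andP[_ ik]; apply: eq_big_nat => j /andP[_ ji].
  have jis : (j + i <= size s)%N by rewrite addnC -leq_subRL // -ltnS.
  have js : (j <= size s)%N := leq_trans (leq_addr i j) jis.
  rewrite take_rcons_le // !drop_rcons // take_rcons_le ?rcons_cat //.
  by rewrite size_drop leq_subRL.
apply: eq_big_nat => j /andP[_ js].
rewrite take_rcons_le // drop_rcons // subnKC; last exact: leqW.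
rewrite [take _ (rcons _ _)]take_oversize ?size_rcons ?size_drop ?subSn //.
by rewrite -(size_rcons s a) drop_size cats1.
Qed.

Lemma outer_rcons V s b (F : word -> word -> V) :
  outer (rcons s b) F = outer s (fun s1 s2 => F s1 (rcons s2 b)) +
    sgn (rcons s b) *: F (rcons s b) [::].
Proof.
rewrite {1}/outer size_rcons big_nat_recr //=; congr (_ + _); last first.
  by rewrite -(size_rcons s b) take_size drop_size.
apply: eq_big_nat => j /andP[_ js].
by rewrite drop_rcons // take_rcons_le.
Qed.

Lemma eq_inner V s (F F' : word -> V) :
  (forall s', F s' = F' s') -> inner s F = inner s F'.
Proof.
by move=> FF'; apply: eq_bigr => i _; apply: eq_bigr => j _; rewrite FF'.
Qed.

Lemma eq_outer V s (F F' : word -> word -> V) :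
  (forall s1 s2, s1 ++ s2 = s -> F s1 s2 = F' s1 s2) -> outer s F = outer s F'.
Proof.
by move=> FF'; apply: eq_bigr => j _; rewrite FF' // cat_take_drop.
Qed.

Lemma linear_inner V W (f : {linear V -> W}) s F :
  f (inner s F) = inner s (fun s' => f (F s')).
Proof.
rewrite linear_sum; apply: eq_bigr => i _; rewrite linear_sum.
by apply: eq_bigr => j _; rewrite linearZ.
Qed.

Lemma linear_outer V W (f : {linear V -> W}) s F :
  f (outer s F) = outer s (fun s1 s2 => f (F s1 s2)).
Proof. by rewrite linear_sum; apply: eq_bigr => i _; rewrite linearZ. Qed.

Lemma innerD V s (F F' : word -> V) :
  inner s (fun s' => F s' + F' s') = inner s F + inner s F'.
Proof.
rewrite -big_split; apply: eq_bigr => i _; rewrite -big_split.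
by apply: eq_bigr => j _; rewrite scalerDr.
Qed.

Lemma outerD V s (F F' : word -> word -> V) :
  outer s (fun s1 s2 => F s1 s2 + F' s1 s2) = outer s F + outer s F'.
Proof. by rewrite -big_split; apply: eq_bigr => i _; rewrite scalerDr. Qed.

Lemma innerZ V s c (F : word -> V) :
  inner s (fun s' => c *: F s') = c *: inner s F.
Proof.
rewrite scaler_sumr; apply: eq_bigr => i _; rewrite scaler_sumr.
by apply: eq_bigr => j _; rewrite !scalerA mulrC.
Qed.

Lemma outerZ V s c (F : word -> word -> V) :
  outer s (fun s1 s2 => c *: F s1 s2) = c *: outer s F.
Proof.
by rewrite scaler_sumr; apply: eq_bigr => i _; rewrite !scalerA mulrC.
Qed.

Lemma outer_eq0 V s (F : word -> word -> V) :
  (forall s1 s2, s1 ++ s2 = s -> F s1 s2 = 0) -> outer s F = 0.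
Proof.
by move=> F0; apply: big1 => j _; rewrite F0 ?scaler0 // cat_take_drop.
Qed.

(** Only the inner operation on the whole word, i = size and j = 0, leaves a word of length 1. *)
Lemma inner_single V b s (F : word -> V) :
  (forall s', size s' != 1%N -> F s' = 0) ->
  inner (b :: s) F = F [:: alg_val m (b :: s)].
Proof.
move=> F0; rewrite /inner big_nat_recr //= big_nat_cond big1 => [|i].
  rewrite add0r subnn big_nat1 take0 /= sgn_nil scale1r take_size.
  by rewrite drop_size.
rewrite andbT => /andP[i1 ik]; rewrite big_nat_cond big1 // => j.
rewrite andbT ltnS => /andP[_ ji]; rewrite F0 ?scaler0 //.
have jk : (j <= size (b :: s))%N := leq_trans ji (leq_subr _ _).
rewrite size_cat size_takel //= addnS eqSS addn_eq0 size_drop subn_eq0.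
by case: j ji jk => //= _ _; rewrite add0n -ltnNge.
Qed.

Lemma outer_rcons_small V s b (F : word -> word -> V) :
  (forall s1 s2, (1 < size s2)%N -> F s1 s2 = 0) ->
  outer (rcons s b) F = sgn s *: F s [:: b] + sgn (rcons s b) *:
    F (rcons s b) [::].
Proof.
move=> F0; rewrite outer_rcons; congr (_ + _).
rewrite /outer big_nat_recr //= take_size drop_size big_nat_cond big1 ?add0r //.
move=> j /andP[/andP[_ js] _].
by rewrite F0 ?scaler0 // size_rcons size_drop ltnS subn_gt0.
Qed.

(** Replacing a subword by its value under m lowers the degree of the word by 1, whence the sign.
    For a subword of degree 0 the truncated predecessor breaks the parity, but there the value of m
    is 0. *)
Lemma inner_sgn V s (F : word -> V) :
  (forall s t, t.+1 != deg s -> m s t = 0) ->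
  (forall s1 s2 n, F (s1 ++ hel (0 : bar n) :: s2) = 0) ->
  inner s (fun s' => sgn s' *: F s') = - (sgn s *: inner s F).
Proof.
move=> m_deg F0; rewrite -scaleNr -innerZ.
apply: eq_big_nat => i /andP[_ ik]; apply: eq_big_nat => j _.
congr (_ *: _).
set s1 := take j s; set s2 := take i (drop j s); set s3 := drop (j + i) s.
have sE : s = s1 ++ s2 ++ s3.
  by rewrite /s1 /s2 /s3 addnC -drop_drop cat_take_drop cat_take_drop.
have [d0|d_gt0] := posnP (deg s2).
  by rewrite /alg_val m_deg ?F0 ?scaler0 // d0.
have val_sgn : sgn [:: alg_val m s2] = - sgn s2.
  rewrite /sgn deg_cons deg_nil addn0 -[in RHS](prednK d_gt0) exprS.
  by rewrite mulN1r opprK.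
congr (_ *: _); rewrite [in RHS]sE !sgn_cat -cat1s sgn_cat val_sgn mulNr mulrN.
by rewrite mulrCA.
Qed.

Lemma mod_sumE (G : complex Q) (mG : mod_ops A G) s g t :
  mod_sum m mG s g t = inner s (fun s' => mG s' g t) +
    outer s (fun s1 s2 => mG s1 (mod_val mG s2 g) t).
Proof.
rewrite /mod_sum triangle_sum; congr (_ + _).
  apply: eq_big_nat => i /andP[_ ik]; apply: eq_big_nat => j /andP[_ ji].
  rewrite ifN //; apply: contraL ji => /eqP->.
  by rewrite -leqNgt subSn.
apply: eq_big_nat => j /andP[_ jk].
by rewrite subKn ?eqxx // ltnW.
Qed.

End Sums.

Lemma small_hel (Q : comPzRingType) (A : complex Q) (b : helt (bar A)) :
  (tag b <= 1)%N -> b = hel (0 : bar A (tag b)).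
Proof.
case: b => -[|[|n]] a // _; rewrite /hel; congr existT; exact: zeromod_eq.
Qed.

Lemma has_split (T : Type) (p : pred T) s :
  has p s -> exists s1 x s2, s = s1 ++ x :: s2 /\ p x.
Proof.
elim: s => //= x s IH /orP[px|/IH[s1 [y [s2 [-> py]]]]].
  by exists [::], x, s.
by exists (x :: s1), y, s2.
Qed.

(** Linearity of [blift] in the bilinear map, through which [syz_op] depends on its algebra
    variables. *)
Lemma blift_comb (Q : comPzRingType) (M N P : lmodType Q) (c : Q)
    (b b1 b2 : M -> N -> P) (b_bil : bilinear_map b) (b1_bil : bilinear_map b1)
    (b2_bil : bilinear_map b2) :
  (forall x y, b x y = c *: b1 x y + b2 x y) ->
  forall u, blift b_bil u = c *: blift b1_bil u + blift b2_bil u.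
Proof.
move=> bE; apply: tensor_ind => [|x y u IH].
  by rewrite !linear0 addr0.
rewrite ![blift _ (_ + _)]linearD IH !blift_pure bE scalerDr.
by rewrite addrACA.
Qed.

Section LinearCombinations.
Context {Q : comPzRingType} {V : lmodType Q}.
Implicit Types (e c : Q) (x y u v : V).

(** This identity and the next have the shapes of the two components of [syz_op], and give its
    linearity in each variable. *)
Lemma linear_opp_scaleD e c x y u v :
  - (e *: (c *: x + y)) + (c *: u + v) =
  c *: (- (e *: x) + u) + (- (e *: y) + v).
Proof.
rewrite scalerDr opprD addrACA; congr (_ + _).
by rewrite scalerDr scalerN !scalerA mulrC.
Qed.

Lemma linear_scaleB e c x y u v :
  e *: ((c *: x + y) - (c *: u + v)) = c *: (e *: (x - u)) + e *: (y - v).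
Proof. by rewrite opprD addrACA -scalerBr scalerDr !scalerA mulrC. Qed.

End LinearCombinations.

(** * The operations on the syzygy complex *)

Section SyzygyOperations.
Context {Q : comPzRingType} {A : complex Q} {unitA : {linear A 0%N -> Q^o}}.
Context {m : Ainf_algebra unitA} {G : complex Q} (mG : Ainf_module m G).
Local Notation bar := (bar A).
Local Notation word := (seq (helt bar)).
Local Notation G0 := (G 0%N).
Local Notation small := (fun b : helt bar => (tag b <= 1)%N).
Implicit Types s : word.
Local Arguments blift : simpl never.
Local Arguments syz_op : simpl never.

Lemma has_small s : s <> [::] -> (deg s <= 1)%N -> has small s.
Proof.
case: s => // b s _; rewrite deg_cons /= => h.
by rewrite (leq_trans (leq_addr _ _) h).
Qed.

Lemma alg_lin0 s1 s2 n t : m (s1 ++ hel (0 : bar n) :: s2) t = 0.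
Proof. exact: (linear_fun0 (alg_lin (alg_ax m) s1 s2 (n := n) t)). Qed.

Lemma mod_lin0 s1 s2 n g t : mG (s1 ++ hel (0 : bar n) :: s2) g t = 0.
Proof. exact: (linear_fun0 (mod_lin (mod_ax mG) s1 s2 g (n := n) t)). Qed.

(* A_+[1] vanishes in degrees 0 and 1. *)
Lemma alg_small s t : has small s -> m s t = 0.
Proof.
by move=> /has_split[s1 [b [s2 [-> /small_hel->]]]]; apply: alg_lin0.
Qed.

Lemma mod_small s g t : has small s -> mG s g t = 0.
Proof.
by move=> /has_split[s1 [b [s2 [-> /small_hel->]]]]; apply: mod_lin0.
Qed.

Lemma alg_tens_bilinear s n t : bilinear_map
  (fun (a : bar n.+1) (g : G0) => pure (m (rcons s (hel a)) t.+1) g).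
Proof.
split=> [g c a a'|a]; last exact: (pure_bilinear _ _).2.
rewrite -!cats1 (alg_lin (alg_ax m)) pureDl pureZl //.
Qed.

Lemma mod_tens_bilinear s n t : bilinear_map
  (fun (a : bar n.+1) (g : G0) => mG (rcons s (hel a)) (hel g) t.+1).
Proof.
split=> [g c a a'|a]; last exact: (mod_linr (mod_ax mG)).
by rewrite -!cats1 (mod_lin (mod_ax mG)).
Qed.

Definition alg_tens s n t :
    {linear tensor (bar n.+1) G0 -> tensor (bar t.+1) G0} :=
  blift (alg_tens_bilinear s n t).

Definition mod_tens s n t : {linear tensor (bar n.+1) G0 -> G t.+1} :=
  blift (mod_tens_bilinear s n t).

Local Arguments alg_tens : simpl never.
Local Arguments mod_tens : simpl never.

Local Notation syz := (syz mG).
Local Notation op := (syz_op mG).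

Lemma syz_opE s n (z : syz n) t : op s (hel z) t =
  (- (sgn s *: alg_tens s n t z.1) + syz_corr s (hel z) t,
   sgn s *: (mod_tens s n t z.1 - mG s (@hel Q G n.+1 z.2) t.+1)).
Proof. by case: z => w g; rewrite -scalerN. Qed.

Lemma syz_corr_linear s n t : linear (fun z : syz n => syz_corr s (hel z) t).
Proof.
move=> c z z'; case: s => [|b []] /=; rewrite ?scaler0 ?addr0 //.
case: n z z' => [|n] z z' /=; rewrite ?scaler0 ?addr0 //.
by rewrite linearP pureDr pureZr.
Qed.

Lemma syz_op_linr s n t : linear (fun z : syz n => op s (hel z) t).
Proof.
move=> c z z'; rewrite !syz_opE syz_corr_linear.
rewrite -[(c *: z + z').1]/(c *: z.1 + z'.1).
rewrite -[(c *: z + z').2]/(c *: z.2 + z'.2).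
rewrite (linearP (alg_tens s n t)) (linearP (mod_tens s n t)).
rewrite (mod_linr (mod_ax mG)).
apply: (@injective_projections (tensor (bar t.+1) G0) (G t.+1)).
  exact: linear_opp_scaleD.
exact: linear_scaleB.
Qed.

Lemma syz_corr_lin s1 s2 n k (z : syz k) t :
  linear (fun b : bar n => syz_corr (s1 ++ hel b :: s2) (hel z) t).
Proof.
move=> c b b'; case: s1 s2 => [|? [|? ?]] [|? ?]; rewrite /= ?scaler0 ?addr0 //.
case: k z => [|k] z; rewrite ?scaler0 ?addr0 //.
by rewrite comp_linear pureDl pureZl.
Qed.

Lemma sgn_mid s1 s2 n (b b' : bar n) :
  sgn (s1 ++ hel b :: s2) = sgn (s1 ++ hel b' :: s2).
Proof. by rewrite /sgn !deg_cat !deg_cons. Qed.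

Lemma syz_op_lin s1 s2 z n t :
  linear (fun b : bar n => op (s1 ++ hel b :: s2) z t).
Proof.
case: z => k z c b b'; rewrite -/(hel z) !syz_opE syz_corr_lin.
rewrite (sgn_mid s1 s2 (c *: b + b') 0) (sgn_mid s1 s2 b 0).
rewrite (sgn_mid s1 s2 b' 0).
rewrite (mod_lin (mod_ax mG)).
set e := sgn _.
rewrite (@blift_comb _ _ _ _ c _ _ _ _
  (alg_tens_bilinear (s1 ++ hel b :: s2) k t)
  (alg_tens_bilinear (s1 ++ hel b' :: s2) k t)) => [|a g]; last first.
  by rewrite !rcons_cat !rcons_cons (alg_lin (alg_ax m)) pureDl pureZl.
rewrite (@blift_comb _ _ _ _ c _ _ _ _
  (mod_tens_bilinear (s1 ++ hel b :: s2) k t)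
  (mod_tens_bilinear (s1 ++ hel b' :: s2) k t)) => [|a g]; last first.
  by rewrite !rcons_cat !rcons_cons (mod_lin (mod_ax mG)).
apply: (@injective_projections (tensor (bar t.+1) G0) (G t.+1)).
  exact: linear_opp_scaleD.
exact: linear_scaleB.
Qed.

Lemma syz_op_deg s z t : t.+1 != (deg s + tag z)%N -> op s z t = 0.
Proof.
case: z => n z td; rewrite -/(hel z) syz_opE.
rewrite (mod_deg (mod_ax mG)) ?addnS ?eqSS //.
have -> : alg_tens s n t z.1 = 0.
  elim/(@tensor_ind Q): z.1 => [|a g w IH]; first by rewrite linear0.
  rewrite linearD IH blift_pure (alg_deg (alg_ax m)) ?pure0l ?addr0 //.
  by rewrite deg_rcons addnS eqSS.
have -> : mod_tens s n t z.1 = 0.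
  elim/(@tensor_ind Q): z.1 => [|a g w IH]; first by rewrite linear0.
  rewrite linearD IH blift_pure (mod_deg (mod_ax mG)) ?addr0 //.
  by rewrite deg_rcons addn0 addnS eqSS.
have -> : syz_corr s (hel z) t = 0.
  case: s td => [|[k b] []] //=; case: n z => // z.
  rewrite deg_cons deg_nil !addn0 => td.
  by rewrite -/(hel b) comp_neq // pure0l.
by rewrite scaler0 subr0 scaler0 oppr0 addr0.
Qed.

Lemma syz_op_m1 n (z : syz n.+1) : op [::] (hel z) n = cdiff syz n z.
Proof.
case: z => w g; rewrite syz_opE sgn_nil /= !scale1r addr0 (mod_m1 (mod_ax mG)).
congr (- _, _ - _).
apply: (tensor_linear_eq (f := alg_tens [::] n.+1 n)
  (g := tmapl G0 (cdiff bar n.+1))) => a g0.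
by rewrite blift_pure tmapl_pure /= (alg_m1 (alg_ax m)).
Qed.

(** * The relations, by components and on generators *)

Local Notation fst_syz t :=
  (fst : {linear (tensor (bar t.+1) G0 * G t.+1)%type -> tensor (bar t.+1) G0}).
Local Notation snd_syz t :=
  (snd : {linear (tensor (bar t.+1) G0 * G t.+1)%type -> G t.+1}).

Lemma mod_sum_fst s z t : (mod_sum m op s z t).1 =
  inner m s (fun s' => (op s' z t).1) +
  outer s (fun s1 s2 => (op s1 (mod_val op s2 z) t).1).
Proof.
rewrite mod_sumE -[LHS]/(fst_syz t _ + fst_syz t _).
by rewrite linear_inner linear_outer.
Qed.

Lemma mod_sum_snd s z t : (mod_sum m op s z t).2 =
  inner m s (fun s' => (op s' z t).2) +
  outer s (fun s1 s2 => (op s1 (mod_val op s2 z) t).2).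
Proof.
rewrite mod_sumE -[LHS]/(snd_syz t _ + snd_syz t _).
by rewrite linear_inner linear_outer.
Qed.

Lemma syz_op_fst s n (z : syz n) t : (op s (hel z) t).1 =
  - (sgn s *: alg_tens s n t z.1) + syz_corr s (hel z) t.
Proof. by rewrite syz_opE. Qed.

Lemma syz_op_snd s n (z : syz n) t : (op s (hel z) t).2 =
  sgn s *: (mod_tens s n t z.1 - mG s (@hel Q G n.+1 z.2) t.+1).
Proof. by rewrite syz_opE. Qed.

Lemma mod_sum_linear s n t :
  linear (fun z : syz n => mod_sum m op s (hel z) t).
Proof.
move=> c z z'; rewrite !mod_sumE scalerDr addrACA -!innerZ -!outerZ.
rewrite -innerD -outerD; congr (_ + _).
  by apply: eq_inner => s'; apply: syz_op_linr.
apply: eq_outer => s1 s2 _; rewrite {1}/mod_val syz_op_linr.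
exact: syz_op_linr.
Qed.

(** The generators from A_+ (x) G_0 and from G. The relations are linear in the module variable, so
    they are checked on these two kinds. *)
Definition syz_l n (a : bar n.+1) (g : G0) : syz n := (pure a g, 0).
Definition syz_r n (g : G n.+1) : syz n := (0, g).

Lemma syz_ind n (P : syz n -> Prop) :
  (forall z z', P z -> P z' -> P (z + z')) -> (forall g, P (syz_r g)) ->
  (forall a g, P (syz_l a g)) -> forall z, P z.
Proof.
move=> PD Pr Pl [w g].
suff Pw : P (w, 0).
  have -> : (w, g) = (w, 0) + syz_r g :> syz n.
    by congr (_, _); rewrite ?addr0 ?add0r.
  exact: PD.
elim/(@tensor_ind Q): w => [|a g0 w IH]; first exact: (Pr 0).
have -> : (pure a g0 + w, 0) = syz_l a g0 + (w, 0) :> syz n.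
  by congr (_, _); rewrite ?addr0 ?add0r.
exact: PD.
Qed.

(** The index [n.+2] puts the generator in positive degree of [syz], where the correction term
    vanishes. *)
Lemma syz_op_l s n (a : bar n.+2) (g : G0) t : op s (hel (syz_l a g)) t =
  (- (sgn s *: pure (m (rcons s (hel a)) t.+1) g),
   sgn s *: mG (rcons s (hel a)) (hel g) t.+1).
Proof.
rewrite syz_opE -[(syz_l a g).1]/(pure a g) !blift_pure (mod_linr0 mG) subr0.
by rewrite (_ : syz_corr _ _ _ = 0) ?addr0 //; case: s => [|? []].
Qed.

Lemma syz_op_r s n (g : G n.+1) t : op s (hel (syz_r g)) t =
  (syz_corr s (hel (syz_r g)) t, - (sgn s *: mG s (hel g) t.+1)).
Proof.
rewrite syz_opE -[(syz_r g).1]/0 (linear0 (alg_tens s n t)).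
by rewrite (linear0 (mod_tens s n t)) scaler0 oppr0 !add0r scalerN. Qed.

Lemma syz_op_l_fst s n (a : bar n.+2) (g : G0) t :
  (op s (hel (syz_l a g)) t).1 = - (sgn s *: pure (m (rcons s (hel a)) t.+1) g).
Proof. by rewrite syz_op_l. Qed.

Lemma syz_op_l_snd s n (a : bar n.+2) (g : G0) t :
  (op s (hel (syz_l a g)) t).2 = sgn s *: mG (rcons s (hel a)) (hel g) t.+1.
Proof. by rewrite syz_op_l. Qed.

Lemma syz_op_r_fst s n (g : G n.+1) t :
  (op s (hel (syz_r g)) t).1 = syz_corr s (hel (syz_r g)) t.
Proof. by rewrite syz_op_r. Qed.

Lemma syz_op_r_snd s n (g : G n.+1) t :
  (op s (hel (syz_r g)) t).2 = - (sgn s *: mG s (hel g) t.+1).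
Proof. by rewrite syz_op_r. Qed.

(** The correction sees only dg of a component of degree 0. Taking a family [z] over all degrees
    states this condition without transport along k = 0. *)
Lemma syz_corr0 s t (z : forall i, syz i) k :
  (k = 0%N -> cdiff G 0%N (z 0%N).2 = 0) -> syz_corr s (hel (z k)) t = 0.
Proof.
by case: s k => [|b []] // [|k] //= ->; rewrite // pure0r.
Qed.

Lemma comp_r n (g : G n.+1) t :
  Defs.comp (hel (syz_r g)) t = (0, Defs.comp (hel g) t.+1) :> syz t.
Proof.
have [->|tn] := eqVneq t n; first by rewrite !comp_hel.
by rewrite !comp_neq.
Qed.

Lemma comp_l n (a : bar n.+1) (g : G0) t :
  Defs.comp (hel (syz_l a g)) t = (pure (Defs.comp (hel a) t.+1) g, 0) :> syz t.
Proof.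
have [->|tn] := eqVneq t n; first by rewrite !comp_hel.
by rewrite !comp_neq // pure0l.
Qed.

Lemma hel_index (X : complex Q) (F : forall t, X t) i j :
  i = j -> hel (F i) = hel (F j).
Proof. by move->. Qed.

Lemma inner_sgn_mod s (w : word) g t :
  inner m s (fun s' => sgn s' *: mG (s' ++ w) g t) =
  - (sgn s *: inner m s (fun s' => mG (s' ++ w) g t)).
Proof.
apply: inner_sgn => [s' t'|s1 s2 n]; first exact: (alg_deg (alg_ax m)).
by rewrite -catA cat_cons mod_lin0.
Qed.

Lemma inner_sgn_alg s (w : word) t :
  inner m s (fun s' => sgn s' *: m (s' ++ w) t) =
  - (sgn s *: inner m s (fun s' => m (s' ++ w) t)).
Proof.
apply: inner_sgn => [s' t'|s1 s2 n]; first exact: (alg_deg (alg_ax m)).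
by rewrite -catA cat_cons alg_lin0.
Qed.

Lemma mod_val0 (g : G0) : mod_val mG [::] (hel g) = hel (0 : G0).
Proof.
transitivity (hel (mG [::] (hel g) 0)).
  by apply: hel_index; rewrite deg_nil.
by rewrite (mod_deg (mod_ax mG)) // deg_nil.
Qed.

Lemma rcons_val_l s n (a : bar n.+2) :
  alg_val m (rcons s (hel a)) = hel (m (rcons s (hel a)) (deg s + n).+1).
Proof. by apply: hel_index; rewrite deg_rcons /= !addnS. Qed.

Lemma mod_val_l s n (a : bar n.+2) (g : G0) :
  mod_val op s (hel (syz_l a g)) = hel (op s (hel (syz_l a g)) (deg s + n)%N).
Proof. by apply: hel_index; rewrite /= addnS. Qed.

(** In the relation of m^G for s, a, g, the inner operations that reach a but not g come from the
    first component of the inner [op], and those that reach g from the second. The one left over is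
    m_1(g) = 0. *)
Lemma mod_sum_l_snd s n (a : bar n.+2) (g : G0) t :
  (mod_sum m op s (hel (syz_l a g)) t).2 =
  - (sgn s *: mod_sum m mG (rcons s (hel a)) (hel g) t.+1).
Proof.
rewrite mod_sum_snd [mod_sum m mG _ _ _]mod_sumE inner_rcons outer_rcons.
rewrite mod_val0 mod_linr0 scaler0 addr0 -addrA scalerDr opprD; congr (_ + _).
  rewrite [LHS](eq_inner m s
    (F' := fun s' => sgn s' *: mG (s' ++ [:: hel a]) (hel g) t.+1)).
    rewrite inner_sgn_mod; congr (- (_ *: _)).
    by apply: eq_inner => s'; rewrite cats1.
  by move=> s'; rewrite syz_op_l_snd cats1.
rewrite -outerD -scaleNr -outerZ; apply: eq_outer => s1 s2 <-.
rewrite mod_val_l syz_op_snd syz_op_l_fst syz_op_l_snd linearN linearZ_LR.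
rewrite blift_pure rcons_val_l (linear_funZ (mod_linr (mod_ax mG) _ _)).
rewrite [mod_val mG _ _](_ : _ =
  hel (mG (rcons s2 (hel a)) (hel g) (deg s2 + n).+1)); last first.
  by apply: hel_index; rewrite deg_rcons addn0 /= !addnS.
by rewrite -opprD -scalerDr scalerN scalerA -sgn_cat scaleNr.
Qed.

(** The relation of m for the word s, a is tensored with g. The outer correction contributes only
    for s = b and the inner operation m_1, where it is b (x) d m_2(a, g). *)
Lemma mod_sum_l_fst s n (a : bar n.+2) (g : G0) t :
  (mod_sum m op s (hel (syz_l a g)) t).1 =
  sgn s *: pure (alg_sum m (rcons s (hel a)) t.+1) g +
  (if s is [:: b] then
     sgn s *: (d1 unitA (hel a) *: pure (Defs.comp b t.+1) g) else 0).
Proof.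
rewrite mod_sum_fst -[alg_sum _ _ _]/(inner m _ (fun s' => m s' t.+1)).
rewrite inner_rcons pureDl scalerDr -addrA.
pose pg := mklin ((pure_bilinear (bar t.+1) G0).1 g).
congr (_ + _).
  rewrite [LHS](eq_inner m s
    (F' := fun s' => (\- pg) (sgn s' *: m (s' ++ [:: hel a]) t.+1))).
    rewrite -(linear_inner m (\- pg)) inner_sgn_alg -scaleNr /=.
    rewrite pureZl scaleNr opprK.
    by congr (_ *: pure _ _); apply: eq_inner => s'; rewrite cats1.
  by move=> s'; rewrite syz_op_l_fst cats1 /= pureZl.
pose C s1 s2 :=
  syz_corr s1 (hel (op s2 (hel (syz_l a g)) (deg s2 + n)%N)) t.
rewrite (eq_outer (F' := fun s1 s2 => sgn s *: pg (m (rcons s1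
  (alg_val m (rcons s2 (hel a)))) t.+1) + C s1 s2)); last first.
  move=> s1 s2 <-.
  rewrite mod_val_l syz_op_fst syz_op_l_fst.
  rewrite [alg_tens _ _ _ _]linearN [alg_tens _ _ _ _]linearZ_LR.
  by rewrite blift_pure rcons_val_l scalerN opprK scalerA -sgn_cat.
rewrite outerD outerZ -(linear_outer pg); congr (_ + _).
(* The correction needs an argument of degree 0, which forces deg s2 = 0; a nonempty such s2 has a
   letter from a zero module. *)
have C0 s1 s2 : s2 <> [::] -> C s1 s2 = 0.
  move=> s2_nil; apply: syz_corr0 (fun i => op s2 (hel (syz_l a g)) i) _ _.
  move/eqP; rewrite addn_eq0 => /andP[/eqP d0 _].
  rewrite syz_op_l_snd mod_small ?scaler0 ?linear0 //.
  by rewrite has_rcons has_small ?d0 ?orbT.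
have -> : outer s C = sgn s *: C s [::].
  rewrite /outer big_nat_recr //= take_size drop_size big_nat_cond.
  rewrite big1 ?add0r // => j /andP[/andP[_ js] _].
  rewrite C0 ?scaler0 // => /(congr1 size)/eqP.
  by rewrite size_drop subn_eq0 leqNgt js.
case: s @pg C0 => [|b [|b' s]] pg C0; rewrite /C ?scaler0 //.
congr (_ *: _).
rewrite (@hel_index _ (fun i => op [::] (hel (syz_l a g)) i) _ n);
  last by rewrite deg_nil.
(* For a in A_1, [cdiff_mod2] turns d m_2(a, g) into d_1(a) g; in higher degrees d_1(a) = 0. *)
case: n a {C pg C0} => [|n] a; last by rewrite scale0r.
rewrite -pureZr -(cdiff_mod2 mG) -[LHS]/(pure _ (cdiff G 0%N _.2)).
by rewrite syz_op_l_snd sgn_nil scale1r.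
Qed.

Lemma mod_val_r_pos s n (g : G n.+2) :
  mod_val op s (hel (syz_r g)) = hel (op s (hel (syz_r g)) (deg s + n)%N).
Proof. by apply: hel_index; rewrite /= addnS. Qed.

Lemma mod_val_r0 s (g : G 1%N) :
  mod_val op s (hel (syz_r g)) = hel (op s (hel (syz_r g)) (deg s).-1).
Proof. by apply: hel_index; rewrite addn0. Qed.

Lemma mod_sum_r_pos s n (g : G n.+2) t :
  mod_sum m op s (hel (syz_r g)) t =
  (0, sgn s *: mod_sum m mG s (hel g) t.+1) :> syz t.
Proof.
have corr0 s' i : syz_corr s' (hel (syz_r g)) i = 0.
  by case: s' => [|b []].
apply: (@injective_projections (tensor (bar t.+1) G0) (G t.+1)); last first.
  rewrite mod_sum_snd mod_sumE scalerDr; congr (_ + _).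
    rewrite [LHS](eq_inner m s
      (F' := fun s' => (\- idfun) (sgn s' *: mG (s' ++ [::]) (hel g) t.+1))).
      rewrite -(linear_inner m (\- idfun)) inner_sgn_mod /= opprK.
      by congr (_ *: _); apply: eq_inner => s'; rewrite cats0.
    by move=> s'; rewrite syz_op_r_snd cats0.
  rewrite -outerZ; apply: eq_outer => s1 s2 <-.
  rewrite mod_val_r_pos syz_op_snd syz_op_r_fst syz_op_r_snd corr0.
  rewrite [mod_tens _ _ _ _]linear0 sub0r -scaleNr.
  rewrite (linear_funZ (mod_linr (mod_ax mG) _ _)) scaleNr opprK.
  rewrite scalerA -sgn_cat.
  congr (_ *: mG _ _ _); apply: esym; apply: hel_index.
  by rewrite /= !addnS.
rewrite mod_sum_fst [X in X + _](_ : _ = 0) ?add0r; last first.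
  rewrite [LHS](eq_inner m s (F' := fun s' => 0 *: (0 : tensor (bar t.+1) G0))).
    by rewrite innerZ scale0r.
  by move=> s'; rewrite syz_op_r_fst corr0 scale0r.
apply: outer_eq0 => s1 s2 _.
rewrite mod_val_r_pos syz_op_fst syz_op_r_fst corr0 [alg_tens _ _ _ _]linear0.
rewrite scaler0 oppr0 add0r.
(* The inner value has degree 0 only if deg s2 = n = 0. For empty s2 it is dg up to sign, and ddg =
   0; otherwise the operation vanishes. *)
apply: syz_corr0 (fun i => op s2 (hel (syz_r g)) i) _ _.
move/eqP; rewrite addn_eq0 => /andP[/eqP d0 /eqP n0].
rewrite syz_op_r_snd -scaleNr linearZ_LR; case: s2 d0 => [|b s2] d0.
  by subst n; rewrite (mod_m1 (mod_ax mG)) cdiffK scaler0.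
by rewrite mod_small ?linear0 ?scaler0 // has_small // d0.
Qed.

Lemma small_tag0 s (b : helt bar) : tag b = 0%N ->
  has small (rcons s b) /\
  has small (rcons s (hel (Defs.comp b (tag b).-1.+1))).
Proof. by move=> b0; rewrite !has_rcons /= b0. Qed.

(* For tag b = 0 the predecessor is truncated, but then both sides vanish. *)
Lemma mod_comp s b g t :
  mG (rcons s (hel (Defs.comp b (tag b).-1.+1))) g t = mG (rcons s b) g t.
Proof.
have [b0|b_gt0] := posnP (tag b); last by rewrite prednK // hel_comp.
by have [h1 h2] := small_tag0 s b0; rewrite !mod_small.
Qed.

Lemma alg_comp s b t :
  m (rcons s (hel (Defs.comp b (tag b).-1.+1))) t = m (rcons s b) t.
Proof.
have [b0|b_gt0] := posnP (tag b); last by rewrite prednK // hel_comp.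
by have [h1 h2] := small_tag0 s b0; rewrite !alg_small.
Qed.

(** Here g lies in degree 0 of [syz], where the correction acts. The word ends in a letter, and it
    is this letter b that is paired with dg in the correction b (x) dg. *)
Lemma mod_sum_r0 s b (g : G 1%N) t :
  mod_sum m op (rcons s b) (hel (syz_r g)) t =
  (0, sgn (rcons s b) *: mod_sum m mG (rcons s b) (hel g) t.+1) :> syz t.
Proof.
pose dg := cdiff G 0%N g.
have corrE s' i : syz_corr s' (hel (syz_r g)) i =
    if s' is [:: b'] then pure (Defs.comp b' i.+1) dg else 0.
  by case: s' => [|b' []].
have mod1 : mG [::] (hel g) 1%N = 0.
  by rewrite (mod_deg (mod_ax mG)) // deg_nil.
apply: (@injective_projections (tensor (bar t.+1) G0) (G t.+1)); last first.
  rewrite mod_sum_snd mod_sumE scalerDr; congr (_ + _).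
    rewrite [LHS](eq_inner m (rcons s b)
      (F' := fun s' => (\- idfun) (sgn s' *: mG (s' ++ [::]) (hel g) t.+1))).
      rewrite -(linear_inner m (\- idfun)) inner_sgn_mod /= opprK.
      by congr (_ *: _); apply: eq_inner => s'; rewrite cats0.
    by move=> s'; rewrite syz_op_r_snd cats0.
  (* Since m_1 sends g to dg in G_0, outside syz, the term with dg is missing
     for s2 = [::]; the correction term restores it for s2 = [:: b]. *)
  pose Y s1 s2 := match s2 with
    | [::] => - (sgn s1 *: mG s1 (hel dg) t.+1)
    | [:: b'] => sgn s1 *: mG (rcons s1 b') (hel dg) t.+1
    | _ => 0 end.
  rewrite -outerZ [LHS](eq_outer (F' := fun s1 s2 => sgn (rcons s b) *:
    mG s1 (mod_val mG s2 (hel g)) t.+1 + Y s1 s2)); last first.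
    move=> s1 s2 <-; rewrite mod_val_r0 syz_op_snd syz_op_r_fst syz_op_r_snd.
    rewrite corrE -scaleNr (linear_funZ (mod_linr (mod_ax mG) _ _)) scaleNr.
    rewrite opprK scalerDr scalerA -sgn_cat addrC.
    case: s2 => [|b' s2].
      rewrite deg_nil mod1 mod_linr0 scaler0 add0r [mod_tens _ _ _ _]linear0.
      rewrite scaler0 cats0 [mod_val _ _ _](_ : _ = hel dg) ?subrr //.
      transitivity (hel (mG [::] (hel g) 0%N)).
        by apply: hel_index; rewrite deg_nil.
      by rewrite (mod_m1 (mod_ax mG)).
    congr (_ *: _ + _); last first.
      case: s2 => [|? ?]; last by rewrite [mod_tens _ _ _ _]linear0 scaler0.
      by rewrite deg_cons deg_nil addn0 blift_pure mod_comp.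
    (* In degree 0 the two truncated tags differ, but both values are zero. *)
    have [d0|d_gt0] := posnP (deg (b' :: s2)); last first.
      rewrite [mod_val _ _ _](_ : _ =
        hel (mG (b' :: s2) (hel g) (deg (b' :: s2)).-1.+1)) //.
      by apply: hel_index; rewrite addn1 prednK.
    have b's2 : has small (b' :: s2) by rewrite has_small // d0.
    by rewrite /mod_val !(mod_small _ _ b's2) !mod_linr0.
  rewrite outerD [X in _ + X](_ : _ = 0) ?addr0 //.
  rewrite outer_rcons_small => [|s1 [|? [|? ?]]] //.
  by rewrite /Y scalerN !scalerA !sgn_sqr !scale1r subrr.
(* In the first component, the correction at the value m(s, b) cancels the outer operation applied
   to the correction term b (x) dg. *)
rewrite mod_sum_fst.
pose Y s1 s2 := if s2 is [:: b'] then
   - (sgn s1 *: pure (m (rcons s1 b') t.+1) dg) else 0.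
rewrite [X in _ + X](eq_outer (F' := Y)); last first.
  move=> s1 s2 _; rewrite mod_val_r0 syz_op_fst syz_op_r_fst corrE.
  rewrite [X in _ + X](syz_corr0 s1 t (z := fun i => op s2 (hel (syz_r g)) i)).
    case: s2 => [|b' [|? ?]]; rewrite /Y addr0.
    - by rewrite [alg_tens _ _ _ _]linear0 scaler0 oppr0.
    - by rewrite deg_cons deg_nil addn0 blift_pure alg_comp.
    - by rewrite [alg_tens _ _ _ _]linear0 scaler0 oppr0.
  move=> d0; rewrite syz_op_r_snd -scaleNr linearZ_LR.
  case: s2 d0 => [|b' s2] d0.
    by rewrite mod1 linear0 scaler0.
  rewrite mod_small ?linear0 ?scaler0 // has_small //.
  by rewrite -[deg _]/(deg (b' :: s2)); case: (deg (b' :: s2)) d0 => [|[]].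
rewrite outer_rcons_small => [|s1 [|? [|? ?]]] //.
rewrite /Y scaler0 addr0 scalerN scalerA sgn_sqr scale1r.
rewrite (eq_inner m _ (F' := fun s' =>
  if s' is [:: b'] then pure (Defs.comp b' t.+1) dg else 0)); last first.
  by move=> s'; rewrite syz_op_r_fst corrE.
have [b1 [s1 ->]] : exists b1 s1, rcons s b = b1 :: s1.
  by case: (s) => [|b1 s1]; [exists b, [::]|exists b1, (rcons s1 b)].
rewrite inner_single => [|[|? []]] //.
rewrite /alg_val comp_val ?subrr // => i.
exact: (alg_deg (alg_ax m)).
Qed.

(** d_1 lives in degree 2, where the sign is 1. *)
Lemma sgn_d1 b : sgn [:: b] * d1 unitA b = d1 unitA b.
Proof.
rewrite /sgn deg_cons deg_nil addn0.
by case: b => [[|[|[|n]]] a] /=; rewrite ?mulr0 // sqrrN expr1n mul1r.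
Qed.

Lemma mod_sum_r s n (g : G n.+1) t : s <> [::] ->
  mod_sum m op s (hel (syz_r g)) t =
  (0, sgn s *: mod_sum m mG s (hel g) t.+1) :> syz t.
Proof.
case: n g => [|n] g s_nil; last exact: mod_sum_r_pos.
by case/lastP: s s_nil => // s b _; apply: mod_sum_r0.
Qed.

(** Covers the relation for m_2 and the higher ones together; on generators each component reduces
    to a relation of m or of m^G. *)
Lemma mod_sum_syz s n (z : syz n) t : s <> [::] ->
  mod_sum m op s (hel z) t =
  (if s is [:: b] then d1 unitA b else 0) *: Defs.comp (hel z) t.
Proof.
move=> s_nil; elim/syz_ind: z => [z z' IH IH'|g|a g].
- rewrite (linear_funD (mod_sum_linear s t)) IH IH' -scalerDr.
  by rewrite (linear_funD (comp_linear t)).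
- rewrite mod_sum_r // comp_r.
  apply: (@injective_projections (tensor (bar t.+1) G0) (G t.+1)).
    by rewrite /= scaler0.
  case: s s_nil => [//|b [|b' s]] _ /=.
    by rewrite (mod_sum2 (mod_ax mG)) scalerA sgn_d1.
  by rewrite (mod_sum3 (mod_ax mG)) // scaler0 scale0r.
(* In degree 0 of [syz] the summand A_+ (x) G_0 is zero. *)
case: n a => [|n] a.
  have -> : syz_l a g = 0 :> syz 0%N.
    by congr (_, _); apply: zeromod_tensor_eq0.
  rewrite (linear_fun0 (mod_sum_linear s t)) (linear_fun0 (comp_linear t)).
  by rewrite scaler0.
rewrite comp_l; apply: (@injective_projections (tensor (bar t.+1) G0) (G t.+1)).
  rewrite mod_sum_l_fst; case: s s_nil => [//|b [|b' s]] _.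
    (* The term - d_1(a) b (x) g of the relation for m_2 cancels the extra term of [mod_sum_l_fst],
       leaving d_1(b) a (x) g. *)
    rewrite (alg_sum2 (alg_ax m)) pureDl -scaleNr !pureZl scalerDr addrAC.
    rewrite -addrA scaleNr -scalerDr subrr scaler0 addr0.
    by rewrite scalerA sgn_d1.
  by rewrite (alg_sum3 (alg_ax m)) ?size_rcons // pure0l scaler0 addr0 scale0r.
rewrite mod_sum_l_snd (mod_sum3 (mod_ax mG)) ?scaler0 ?oppr0.
  exact/esym/scaler0.
by rewrite size_rcons; case: s s_nil.
Qed.

Theorem syz_op_axioms : Ainf_module_axioms unitA m op.
Proof.
split.
- exact: syz_op_deg.
- exact: syz_op_lin.
- exact: syz_op_linr.
- exact: syz_op_m1.
- by move=> x [n z] t; apply: mod_sum_syz.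
- by move=> [|b [|b' s]] [n z] t // _; rewrite mod_sum_syz // scale0r.
Qed.

End SyzygyOperations.

Theorem propositionB
  (Q R : comPzRingType) (pi : {rmorphism Q -> R})
  (pi_surj : forall r : R, exists q : Q, pi q = r)
  (M : lmodType R)
  (A : complex Q) (unitA : {linear A 0%N -> Q^o}) (unitA_bij : bijective unitA)
  (epsA : chain_map A (stalk (restr pi R^o))) (resA : resolution epsA)
  (m : Ainf_algebra unitA)
  (G : complex Q)
  (epsG : chain_map G (stalk (restr pi M))) (resG : resolution epsG)
  (mG : Ainf_module m G) :
  Ainf_module_axioms unitA m (syz_op mG) /\
  exists eps : chain_map (syz mG) (stalk (restr pi (syzygy (epsG 0%N)))),
    resolution eps.
Proof.
split; first exact: syz_op_axioms.
eexists; exact: (syz_aug_resolution pi_surj unitA_bij resA resG mG).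
Qed.
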